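(* Let $N\in\mathbb N$, let $d\in\mathbb Z$, and let $C$ be a chain complex of finite rank free $\mathbb Z^N$-persistence modules such that the modules $H_d(C),H_{d+1}(C),\dotsc,H_{d+N}(C)$ eventually vanish. Then there is a natural isomorphism (natural in $C$) of $\mathbb Z^N$-persistence modules \[ H_d(C)^*\;\cong\; H^{d+N}(C^\dagger). \]
   Context: Fix a field $\mathbb F$ and $N\in\mathbb N$; $\mathbb Z^N$ carries the product partial order. A $\mathbb Z^N$-persistence module is a functor $M$ from the poset $\mathbb Z^N$ to finite-dimensional $\mathbb F$-vector spaces, with components $M_z$ and structure maps $M_{z'z}\colon M_z\to M_{z'}$ for $z\le z'$; morphisms are natural transformations, and $\operatorname{Hom}(L,M)$ is the vector space of morphisms. Kernels, cokernels, and (co)homology of (co)chain complexes are computed componentwise. The shift $M\langle z\rangle$ has components $M\langle z\rangle_w=M_{z+w}$. For $z\in\mathbb Z^N$, $F(z)$ is the persistence module with $F(z)_v=\mathbb F$ if $z\le v$ and $0$ otherwise, with identities as structure maps between nonzero components. A module is free of finite rank if it is isomorphic to a finite direct sum of modules $F(z)$ with $z\in\mathbb Z^N$. Pointwise dual: $M^*$ has components $(M^* )_z=\operatorname{Hom}_{\mathbb F}(M_{-z},\mathbb F)$ and structure maps $(M^* )_{z'z}=(M_{-z',-z})^*$ (here $M_{-z,-z'}\colon M_{-z'}\to M_{-z}$ is the structure map of $M$ being dualized). Global dual: with $\mathbf 1=(1,\dotsc,1)\in\mathbb Z^N$, $M^\dagger$ is the persistence module with components $(M^\dagger)_z=\operatorname{Hom}(M,F(\mathbf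 1)\langle z\rangle)=\operatorname{Hom}(M,F(\mathbf 1-z))$ and the induced structure maps; in particular $F(z)^\dagger\cong F(\mathbf 1-z)$. Both duals are contravariant; applied degreewise to a chain complex $C$ they give cochain complexes, e.g. $(C^\dagger)^d=(C_d)^\dagger$. A persistence module $M$ eventually vanishes if its support $\{z\in\mathbb Z^N: M_z\ne 0\}$ is bounded above in $\mathbb Z^N$. *)

(* Defs.v *)
From HB Require Import structures.
From mathcomp Require Import all_boot all_order all_algebra.
From mathcomp Require Import boolp functions.

Set Implicit Arguments.
Unset Strict Implicit.
Unset Printing Implicit Defensive.

Import Order.TTheory GRing.Theory Num.Theory.
Local Open Scope ring_scope.

Section VectorSpaces.
Variable F : fieldType.
Implicit Types V W : lmodType F.

Definition finite_dim V : Prop :=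
  exists (n : nat) (b : 'I_n -> V),
    forall v, exists a : 'I_n -> F, v = \sum_i a i *: b i.

Lemma linear_ext V W (f g : {linear V -> W}) : (forall x, f x = g x) -> f = g.
Proof.
case: f g => [f cf] [g cg] /= /funext efg; case: _ / efg cg => cg.
congr GRing.Linear.Pack; case: cf cg => [[cf1] [cf2]] [[cg1] [cg2]].
have ->: cf1 = cg1 by exact: Prop_irrelevance.
by have -> : cf2 = cg2 by exact: Prop_irrelevance.
Qed.

Definition dualv V := {linear V -> F^o}.

Section DualSpace.
Variable V : lmodType F.

HB.instance Definition _ := gen_eqMixin (dualv V).
HB.instance Definition _ := gen_choiceMixin (dualv V).

Definition dualv_zero : dualv V := \0.
Definition dualv_add (f g : dualv V) : dualv V := f \+ g.
Definition dualv_opp (f : dualv V) : dualv V := \- f.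
Definition dualv_scale (a : F) (f : dualv V) : dualv V := a \*: f.

Fact dualv_addA : associative dualv_add.
Proof. by move=> f g h; apply: linear_ext => x /=; rewrite addrA. Qed.
Fact dualv_addC : commutative dualv_add.
Proof. by move=> f g; apply: linear_ext => x /=; rewrite addrC. Qed.
Fact dualv_add0 : left_id dualv_zero dualv_add.
Proof. by move=> f; apply: linear_ext => x /=; rewrite add0r. Qed.
Fact dualv_addN : left_inverse dualv_zero dualv_opp dualv_add.
Proof. by move=> f; apply: linear_ext => x /=; rewrite addNr. Qed.

HB.instance Definition _ :=
  GRing.isZmodule.Build (dualv V) dualv_addA dualv_addC dualv_add0 dualv_addN.

Fact dualv_scaleA a b f : dualv_scale a (dualv_scale b f) = dualv_scale (a * b) f.
Proof. by apply: linear_ext => x /=; rewrite scalerA. Qed.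
Fact dualv_scale1 : left_id 1 dualv_scale.
Proof. by move=> f; apply: linear_ext => x /=; rewrite scale1r. Qed.
Fact dualv_scaleDr : right_distributive dualv_scale +%R.
Proof. by move=> a f g; apply: linear_ext => x /=; rewrite scalerDr. Qed.
Fact dualv_scaleDl f : {morph dualv_scale^~ f : a b / a + b}.
Proof. by move=> a b; apply: linear_ext => x /=; rewrite scalerDl. Qed.

HB.instance Definition _ := GRing.Zmodule_isLmodule.Build F (dualv V)
  dualv_scaleA dualv_scale1 dualv_scaleDr dualv_scaleDl.

End DualSpace.

Section FiniteDimension.

Lemma finite_dim_sub V W (f : {linear V -> W}) :
  injective f -> finite_dim W -> finite_dim V.
Proof.
move=> f_inj [n [b bW]].
pose T (r : 'rV[F]_n) := \sum_i r 0 i *: b i.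
have TL a r s : T (a *: r + s) = a *: T r + T s.
  rewrite /T scaler_sumr -big_split /=; apply: eq_bigr => i _.
  by rewrite !mxE scalerDl scalerA.
have T0 : T 0 = 0 by rewrite /T big1 // => i _; rewrite mxE scale0r.
have Tsum (I : finType) (a : I -> F) (r : I -> 'rV_n) :
    T (\sum_i a i *: r i) = \sum_i a i *: T (r i).
  elim/big_rec2: _ => [|i y x _ <-]; first exact: T0.
  by rewrite TL.
pose ok m (A : 'M_(m, n)) := forall i, exists v, f v = T (row i A).
pose P k := `[< exists A : 'M_n, ok n A /\ \rank A = k >].
have P0 : exists k, P k.
  exists 0%N; apply/asboolP; exists 0; split; last exact: mxrank0.
  by move=> i; exists 0; rewrite linear0 row0 T0.
have Ple k : P k -> (k <= n)%N by move=> /asboolP[A [_ <-]]; exact: rank_leq_row.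
case: (ex_maxnP P0 Ple) => k /asboolP[A [okA rkA]] maxk {P0 Ple}.
have /choice[v fv] := okA.
exists n, v => x; have [r fr] := bW (f x).
have {}fr : f x = T (\row_i r i).
  by rewrite fr; apply: eq_bigr => i _; rewrite mxE.
move: (\row_i r i) fr => {}r fr.
have ok_col : ok _ (col_mx A r).
  move=> i; case: (split_ordP i) => j ->.
    by rewrite rowKu; exact: okA.
  by rewrite rowKd; exists x; rewrite fr; congr T; apply/rowP => l; rewrite !mxE ord1.
have rA : (r <= A)%MS.
  suff: (A + r <= A)%MS by rewrite addsmx_sub => /andP[].
  rewrite -(geq_leqif (mxrank_leqif_sup (addsmxSl A r))) rkA.
  apply: maxk; apply/asboolP; exists (A + r)%MS; split=> // i.
  have /submxP[D ->] : (row i (A + r)%MS <= col_mx A r)%MS.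
    by rewrite -addsmxE row_sub.
  have /choice[u fu] := ok_col.
  exists (\sum_j D 0 j *: u j); rewrite mulmx_sum_row Tsum linear_sum /=.
  by apply: eq_bigr => j _; rewrite linearZ /= fu.
have /submxP[D rE] := rA.
exists (fun i => D 0 i); apply: f_inj.
rewrite fr rE mulmx_sum_row Tsum linear_sum /=.
by apply: eq_bigr => j _; rewrite linearZ /= fv.
Qed.

Lemma finite_dim_surj V W (f : {linear V -> W}) :
  (forall y, exists x, f x = y) -> finite_dim V -> finite_dim W.
Proof.
move=> f_surj [n [b bV]]; exists n, (fun i => f (b i)) => y.
have [x <-] := f_surj y; have [a ->] := bV x; exists a.
by rewrite linear_sum; apply: eq_bigr => i _; rewrite linearZ.
Qed.

Lemma finite_dim_row n : finite_dim 'rV[F]_n.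
Proof.
exists n, (fun i => delta_mx 0 i) => v; exists (fun i => v 0 i).
exact: row_sum_delta.
Qed.

Lemma finite_dim_pair V W :
  finite_dim V -> finite_dim W -> finite_dim (V * W)%type.
Proof.
move=> [m [b bV]] [n [c cW]].
exists (m + n)%N, (fun i => match fintype.split i with
  | inl j => (b j, 0) | inr j => (0, c j) end) => -[x y].
have [a ax] := bV x; have [a' ay] := cW y.
exists (fun i => match fintype.split i with inl j => a j | inr j => a' j end).
have pairE (I : finType) (u : I -> V) (w : I -> W) :
    \sum_i (u i, w i) = (\sum_i u i, \sum_i w i).
  by elim/big_rec3: _ => // i p q r _ ->.
have sl (i : 'I_m) : fintype.split (lshift n i) = inl i := unsplitK (inl i).
have sr (i : 'I_n) : fintype.split (rshift m i) = inr i := unsplitK (inr i).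
rewrite big_split_ord /=.
rewrite (eq_bigr (fun i => (a i *: b i, 0))) => [|i _]; last first.
  by rewrite sl; congr pair; exact: scaler0.
rewrite [X in _ + X](eq_bigr (fun i => (0, a' i *: c i))) => [|i _]; last first.
  by rewrite sr; congr pair; exact: scaler0.
rewrite !pairE -ax -ay !big1_eq.
by congr pair; rewrite /= ?addr0 ?add0r.
Qed.

Lemma finite_dim_dual V : finite_dim V -> finite_dim (dualv V).
Proof.
move=> [n [b bV]].
pose ev (u : dualv V) : 'rV[F]_n := \row_i u (b i).
have ev_lin : linear ev by move=> a u v; apply/rowP => i; rewrite !mxE.
pose evm := GRing.isLinear.Build F (dualv V) 'rV[F]_n *:%R ev ev_lin.
pose evl : {linear dualv V -> 'rV[F]_n} := HB.pack ev evm.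
apply: (finite_dim_sub (f := evl)) (finite_dim_row n) => u v /rowP uv.
apply: linear_ext => x; have [a ->] := bV x; rewrite !linear_sum.
by apply: eq_bigr => i _; have := uv i; rewrite !linearZ /= !mxE => ->.
Qed.

End FiniteDimension.
Section Transpose.
Variables (V W : lmodType F) (f : {linear V -> W}).

Definition dualv_map (u : dualv W) : dualv V := u \o f.

Fact dualv_map_linear : linear dualv_map.
Proof. by move=> a u v; apply: linear_ext. Qed.
HB.instance Definition _ :=
  GRing.isLinear.Build F (dualv W) (dualv V) *:%R dualv_map dualv_map_linear.

End Transpose.

Section Kernel.
Variables (V W : lmodType F) (f : {linear V -> W}).

Definition kerv_pred : {pred V} := [pred x | f x == 0].

Fact kerv_submod : submod_closed kerv_pred.
Proof.
split=> [|a x y]; rewrite !inE ?linear0 // => /eqP fx /eqP fy.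
by rewrite linearP fx fy scaler0 addr0.
Qed.
HB.instance Definition _ := GRing.isSubmodClosed.Build F V kerv_pred kerv_submod.

Record kerv := Kerv { kerv_val :> V; kerv_valP : kerv_val \in kerv_pred }.
HB.instance Definition _ := [isSub for kerv_val].
HB.instance Definition _ := [Choice of kerv by <:].
HB.instance Definition _ := [SubChoice_isSubZmodule of kerv by <:].
HB.instance Definition _ := [SubZmodule_isSubLmodule of kerv by <:].

Lemma kervE (x : kerv) : f (val x) = 0.
Proof. exact/eqP/(valP x). Qed.

Section Lift.
Variables (U : lmodType F) (g : {linear U -> V}) (fg0 : forall x, f (g x) = 0).

Fact kerv_lift_subproof x : g x \in kerv_pred.
Proof. by rewrite inE fg0. Qed.
Definition kerv_lift x : kerv := Kerv (kerv_lift_subproof x).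
Fact kerv_lift_linear : linear kerv_lift.
Proof. by move=> a x y; apply: val_inj; rewrite /= linearP. Qed.
HB.instance Definition _ :=
  GRing.isLinear.Build F U kerv *:%R kerv_lift kerv_lift_linear.
End Lift.

End Kernel.

Section Cokernel.
Variables (V W : lmodType F) (f : {linear V -> W}).

Definition imv_pred : {pred W} := [pred y | `[< exists x, f x = y >]].

Lemma imvP y : reflect (exists x, f x = y) (y \in imv_pred).
Proof. exact: asboolP. Qed.

Fact imv_submod : submod_closed imv_pred.
Proof.
split=> [|a x y]; first by apply/imvP; exists 0; rewrite linear0.
move=> /imvP[u <-] /imvP[v <-]; apply/imvP.
by exists (a *: u + v); rewrite linearP.
Qed.
HB.instance Definition _ := GRing.isSubmodClosed.Build F W imv_pred imv_submod.

Definition cokerv := Quotient.quot imv_pred.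
HB.instance Definition _ := GRing.Zmodule.on cokerv.

Definition cokerv_pi (y : W) : cokerv := \pi_(Quotient.quot imv_pred)%qT y.
Definition cokerv_repr (q : cokerv) : W := generic_quotient.repr q.

Lemma cokerv_reprK : cancel cokerv_repr cokerv_pi.
Proof. by move=> q; rewrite /cokerv_pi /cokerv_repr generic_quotient.reprK. Qed.

Lemma cokerv_eqP x y : cokerv_pi x = cokerv_pi y <-> exists u, f u = x - y.
Proof.
split=> [/eqP|/imvP]; first by rewrite -Quotient.idealrBE => /imvP.
by rewrite Quotient.idealrBE => /eqP.
Qed.

Lemma cokerv_piD x y : cokerv_pi (x + y) = cokerv_pi x + cokerv_pi y.
Proof. by rewrite /cokerv_pi raddfD. Qed.

Definition cokerv_scale (a : F) (q : cokerv) : cokerv :=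
  cokerv_pi (a *: cokerv_repr q).

Fact cokerv_scale_pi a y : cokerv_scale a (cokerv_pi y) = cokerv_pi (a *: y).
Proof.
apply/cokerv_eqP.
have /cokerv_eqP[u fu] := cokerv_reprK (cokerv_pi y).
by exists (a *: u); rewrite linearZ /= fu scalerBr.
Qed.

Fact cokerv_scaleA a b q :
  cokerv_scale a (cokerv_scale b q) = cokerv_scale (a * b) q.
Proof. by rewrite cokerv_scale_pi scalerA. Qed.
Fact cokerv_scale1 : left_id 1 cokerv_scale.
Proof. by move=> q; rewrite /cokerv_scale scale1r cokerv_reprK. Qed.
Fact cokerv_scaleDr : right_distributive cokerv_scale +%R.
Proof.
move=> a p q; rewrite -(cokerv_reprK p) -(cokerv_reprK q) -cokerv_piD.
by rewrite !cokerv_scale_pi scalerDr cokerv_piD.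
Qed.
Fact cokerv_scaleDl q : {morph cokerv_scale^~ q : a b / a + b}.
Proof.
by move=> a b; rewrite -(cokerv_reprK q) !cokerv_scale_pi scalerDl cokerv_piD.
Qed.
HB.instance Definition _ := GRing.Zmodule_isLmodule.Build F cokerv
  cokerv_scaleA cokerv_scale1 cokerv_scaleDr cokerv_scaleDl.

Fact cokerv_pi_linear : linear cokerv_pi.
Proof.
by move=> a x y; rewrite cokerv_piD -cokerv_scale_pi.
Qed.
HB.instance Definition _ :=
  GRing.isLinear.Build F W cokerv *:%R cokerv_pi cokerv_pi_linear.

End Cokernel.

Section CokernelMap.
Variables (V W V' W' : lmodType F).
Variables (f : {linear V -> W}) (f' : {linear V' -> W'}).
Variables (b : {linear W -> W'}).
Hypothesis bf : forall x, exists y, f' y = b (f x).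

Definition cokerv_map (q : cokerv f) : cokerv f' :=
  cokerv_pi f' (b (cokerv_repr q)).

Lemma cokerv_map_pi x : cokerv_map (cokerv_pi f x) = cokerv_pi f' (b x).
Proof.
apply/cokerv_eqP; rewrite -linearB.
have /cokerv_eqP[u <-] := cokerv_reprK (cokerv_pi f x).
exact: bf.
Qed.

Fact cokerv_map_linear : linear cokerv_map.
Proof.
move=> a p q; rewrite -(cokerv_reprK p) -(cokerv_reprK q) -linearP.
by rewrite !cokerv_map_pi !linearP.
Qed.

Definition cokerv_lin : {linear cokerv f -> cokerv f'} :=
  HB.pack cokerv_map
    (GRing.isLinear.Build F (cokerv f) (cokerv f') *:%R cokerv_map
       cokerv_map_linear).

End CokernelMap.

Definition cell (b : bool) : lmodType F :=
  if b then (F^o : lmodType F) else ('rV[F]_0 : lmodType F).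

Definition cell_map (b c : bool) : cell b -> cell c :=
  match b, c with true, true => id | _, _ => fun=> 0 end.

Fact cell_map_linear b c : linear (@cell_map b c).
Proof. by case: b c => [] [] a x y //=; rewrite scaler0 addr0. Qed.
HB.instance Definition _ b c :=
  GRing.isLinear.Build F (cell b) (cell c) *:%R (@cell_map b c)
    (@cell_map_linear b c).

Lemma cell_map_id b x : @cell_map b b x = x.
Proof. by case: b x => //= x; rewrite [x]thinmx0. Qed.

Lemma cell_map_comp b c d x : (b ==> c) ->
  @cell_map b d x = @cell_map c d (@cell_map b c x).
Proof. by case: b c d x => [] [] [] //= x _; rewrite [RHS]thinmx0. Qed.

End VectorSpaces.

(** [Z^N] is ['I_N -> int]; its product order and its addition are the pointwise
    ones that [boolp] and [functions] put on function types. *)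
Section PersistenceModules.
Variables (F : fieldType) (N : nat).
Local Notation ZN := ('I_N -> int).

(** Functors from [Z^N] to all vector spaces, since the global dual of a
    pointwise finite-dimensional module may be infinite-dimensional. Persistence
    modules are those satisfying [pfd], a full subcategory; everything built
    below from a complex of free modules of finite rank satisfies [pfd], see
    [free_pfd], [chain_homology_pfd], [pdual_pfd], [gdual_pfd] and
    [cohomology_gdual_pfd]. *)
Record pmod := PMod {
  pm_obj :> ZN -> lmodType F;
  pm_map : forall z w : ZN, (z <= w)%O -> {linear pm_obj z -> pm_obj w};
  pm_id : forall (z : ZN) (h : (z <= z)%O) x, pm_map h x = x;
  pm_comp : forall (u v w : ZN) (h1 : (u <= v)%O) (h2 : (v <= w)%O)
    (h : (u <= w)%O) x, pm_map h x = pm_map h2 (pm_map h1 x) }.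
Arguments pm_map : clear implicits.
Arguments pm_map M {z w} h : rename.

Definition pfd (M : pmod) : Prop := forall z, finite_dim (M z).

Record phom (M L : pmod) := PHom {
  phom_fun :> forall z, {linear M z -> L z};
  phom_nat : forall (z w : ZN) (h : (z <= w)%O) x,
    phom_fun w (pm_map M h x) = pm_map L h (phom_fun z x) }.

Lemma phom_ext M L (f g : phom M L) : (forall z x, f z x = g z x) -> f = g.
Proof.
case: f g => [f hf] [g hg] /= efg.
have {efg} efg : f = g by apply: functional_extensionality_dep => z; exact/linear_ext/efg.
by case: _ / efg hg => hg; congr PHom; exact: Prop_irrelevance.
Qed.

Section HomSpace.
Variables M L : pmod.

HB.instance Definition _ := gen_eqMixin (phom M L).
HB.instance Definition _ := gen_choiceMixin (phom M L).

Definition phom_zero : phom M L.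
Proof. by exists (fun z => \0) => z w h x /=; rewrite linear0. Defined.
Definition phom_add (f g : phom M L) : phom M L.
Proof. by exists (fun z => f z \+ g z) => z w h x /=; rewrite linearD !phom_nat. Defined.
Definition phom_opp (f : phom M L) : phom M L.
Proof. by exists (fun z => \- f z) => z w h x /=; rewrite linearN phom_nat. Defined.
Definition phom_scale (a : F) (f : phom M L) : phom M L.
Proof. by exists (fun z => a \*: f z) => z w h x /=; rewrite linearZ phom_nat. Defined.

Fact phom_addA : associative phom_add.
Proof. by move=> f g h; apply: phom_ext => z x /=; rewrite addrA. Qed.
Fact phom_addC : commutative phom_add.
Proof. by move=> f g; apply: phom_ext => z x /=; rewrite addrC. Qed.
Fact phom_add0 : left_id phom_zero phom_add.
Proof. by move=> f; apply: phom_ext => z x /=; rewrite add0r. Qed.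
Fact phom_addN : left_inverse phom_zero phom_opp phom_add.
Proof. by move=> f; apply: phom_ext => z x /=; rewrite addNr. Qed.
HB.instance Definition _ :=
  GRing.isZmodule.Build (phom M L) phom_addA phom_addC phom_add0 phom_addN.

Fact phom_scaleA a b f : phom_scale a (phom_scale b f) = phom_scale (a * b) f.
Proof. by apply: phom_ext => z x /=; rewrite scalerA. Qed.
Fact phom_scale1 : left_id 1 phom_scale.
Proof. by move=> f; apply: phom_ext => z x /=; rewrite scale1r. Qed.
Fact phom_scaleDr : right_distributive phom_scale +%R.
Proof. by move=> a f g; apply: phom_ext => z x /=; rewrite scalerDr. Qed.
Fact phom_scaleDl f : {morph phom_scale^~ f : a b / a + b}.
Proof. by move=> a b; apply: phom_ext => z x /=; rewrite scalerDl. Qed.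
HB.instance Definition _ := GRing.Zmodule_isLmodule.Build F (phom M L)
  phom_scaleA phom_scale1 phom_scaleDr phom_scaleDl.

End HomSpace.

Definition phom_id M : phom M M.
Proof. by exists (fun z => idfun). Defined.

Definition phom_comp M L K (g : phom L K) (f : phom M L) : phom M K.
Proof. by exists (fun z => g z \o f z) => z w h x /=; rewrite !phom_nat. Defined.

Definition is_iso M L (f : phom M L) : Prop :=
  exists g : phom L M, phom_comp g f = phom_id M /\ phom_comp f g = phom_id L.

Definition isomorphic M L : Prop := exists f : phom M L, is_iso f.

Section Kernel.
Variables (M L : pmod) (f : phom M L).

Fact pker_subproof z w (h : (z <= w)%O) (x : kerv (f z)) :
  f w (pm_map M h (val x)) = 0.
Proof. by rewrite phom_nat kervE linear0. Qed.

Definition pker : pmod.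
Proof.
exists (fun z => kerv (f z) : lmodType F)
  (fun z w h => kerv_lift (g := pm_map M h \o val) (pker_subproof h)).
- by move=> z h x; apply: val_inj; rewrite /= pm_id.
- by move=> u v w h1 h2 h x; apply: val_inj; rewrite /= (pm_comp h1 h2).
Defined.

Definition pker_incl : phom pker M.
Proof. by exists (fun z => val : {linear kerv (f z) -> M z}). Defined.

Definition pker_lift (K : pmod) (g : phom K M)
  (fg0 : forall z x, f z (g z x) = 0) : phom K pker.
Proof.
exists (fun z => kerv_lift (g := g z) (fg0 z) : {linear K z -> kerv (f z)}).
by move=> z w h x; apply: val_inj; rewrite /= phom_nat.
Defined.

End Kernel.

Section Cokernel.
Variables (M L : pmod) (f : phom M L).

Fact pcoker_subproof z w (h : (z <= w)%O) (x : M z) :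
  exists y, f w y = pm_map L h (f z x).
Proof. by exists (pm_map M h x); rewrite phom_nat. Qed.

Definition pcoker : pmod.
Proof.
exists (fun z => cokerv (f z) : lmodType F)
  (fun z w h => cokerv_lin (pcoker_subproof h)).
- move=> z h x; rewrite -(cokerv_reprK x) /=.
  by rewrite (cokerv_map_pi (pcoker_subproof h)) pm_id.
- move=> u v w h1 h2 h x; rewrite -(cokerv_reprK x) /=.
  rewrite !(cokerv_map_pi (pcoker_subproof _)); congr cokerv_pi; exact: pm_comp.
Defined.

Definition pcoker_proj : phom L pcoker.
Proof.
exists (fun z => cokerv_pi (f z) : {linear L z -> cokerv (f z)}) => z w h x.
by rewrite [RHS](cokerv_map_pi (pcoker_subproof h)).
Defined.

End Cokernel.

Section CokernelFunctoriality.
Variables (M L M' L' : pmod) (f : phom M L) (f' : phom M' L') (b : phom L L').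
Hypothesis bf : forall z x, exists y, f' z y = b z (f z x).

Definition pcoker_map : phom (pcoker f) (pcoker f').
Proof.
exists (fun z => cokerv_lin (bf (z := z))) => z w h x.
rewrite -(cokerv_reprK x) /= (cokerv_map_pi (pcoker_subproof f h)).
rewrite !(cokerv_map_pi (bf (z := _))) (cokerv_map_pi (pcoker_subproof f' h)).
by rewrite phom_nat.
Defined.

Lemma pcoker_map_proj z x :
  pcoker_map z (pcoker_proj f z x) = pcoker_proj f' z (b z x).
Proof. exact: cokerv_map_pi (bf (z := z)) x. Qed.

End CokernelFunctoriality.

Section Homology.
Variables (A B C : pmod) (f : phom A B) (g : phom B C).
Hypothesis gf0 : forall z x, g z (f z x) = 0.

Definition homology : pmod := pcoker (pker_lift gf0).

Lemma homology_pfd : pfd B -> pfd homology.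
Proof.
move=> B_fd z.
apply: (@finite_dim_surj F (kerv (g z)) _ (pcoker_proj (pker_lift gf0) z)).
  by move=> y; exists (cokerv_repr y); exact: cokerv_reprK.
exact: (@finite_dim_sub F (kerv (g z)) (B z) val val_inj).
Qed.

End Homology.

Section HomologyMap.
Variables (A B C A' B' C' : pmod).
Variables (f : phom A B) (g : phom B C) (gf0 : forall z x, g z (f z x) = 0).
Variables (f' : phom A' B') (g' : phom B' C').
Hypothesis gf0' : forall z x, g' z (f' z x) = 0.
Variables (a : phom A A') (b : phom B B') (c : phom C C').
Hypotheses (ba : forall z x, b z (f z x) = f' z (a z x))
           (cb : forall z x, c z (g z x) = g' z (b z x)).

Fact homology_map_subproof1 z (x : kerv (g z)) : g' z (b z (val x)) = 0.
Proof. by rewrite -cb kervE linear0. Qed.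

Definition cycle_map : phom (pker g) (pker g') :=
  pker_lift (g := phom_comp b (pker_incl g)) homology_map_subproof1.

Fact homology_map_subproof2 z x :
  exists y, pker_lift gf0' z y = cycle_map z (pker_lift gf0 z x).
Proof. by exists (a z x); apply: val_inj; rewrite /= ba. Qed.

Definition homology_map : phom (homology gf0) (homology gf0') :=
  pcoker_map homology_map_subproof2.

End HomologyMap.

Section PointwiseDual.

Fact opp_le (z w : ZN) : (z <= w)%O -> (- w <= - z)%O.
Proof. by move=> /lefP h; apply/lefP => i; rewrite /= lerN2. Qed.

Definition pdual (M : pmod) : pmod.
Proof.
exists (fun z => dualv (M (- z)) : lmodType F)
  (fun z w h => dualv_map (pm_map M (opp_le h))
              : {linear dualv (M (- z)) -> dualv (M (- w))}).
- by move=> z h u; apply: linear_ext => x /=; rewrite pm_id.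
- move=> u v w h1 h2 h y; apply: linear_ext => x /=.
  by rewrite (pm_comp (opp_le h2) (opp_le h1)).
Defined.

Definition pdual_map M L (f : phom M L) : phom (pdual L) (pdual M).
Proof.
exists (fun z => dualv_map (f (- z))
               : {linear dualv (L (- z)) -> dualv (M (- z))}).
by move=> z w h u; apply: linear_ext => x /=; rewrite phom_nat.
Defined.

Lemma pdual_pfd M : pfd M -> pfd (pdual M).
Proof. by move=> M_fd z; exact: finite_dim_dual. Qed.

End PointwiseDual.

Section Shift.
Variable M : pmod.

Fact addl_le (z u v : ZN) : (u <= v)%O -> (z + u <= z + v)%O.
Proof. by move=> /lefP h; apply/lefP => i; rewrite /= lerD2l. Qed.

Fact addr_le (z w u : ZN) : (z <= w)%O -> (z + u <= w + u)%O.
Proof. by move=> /lefP h; apply/lefP => i; rewrite /= lerD2r. Qed.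

Definition shift (z : ZN) : pmod.
Proof.
exists (fun u => M (z + u)) (fun u v h => pm_map M (addl_le z h)).
- by move=> u h x; exact: pm_id.
- by move=> u v w h1 h2 h x; exact: pm_comp.
Defined.

Definition shift_map (z w : ZN) (h : (z <= w)%O) : phom (shift z) (shift w).
Proof.
exists (fun u => pm_map M (addr_le u h) : {linear shift z u -> shift w u}).
move=> u v k x /=.
by rewrite -!(pm_comp _ _ (le_trans (addr_le u h) (addl_le w k))).
Defined.

End Shift.

Definition free1 (z : ZN) : pmod.
Proof.
exists (fun v => cell F (z <= v)%O)
  (fun v w _ => @cell_map F (z <= v)%O (z <= w)%O).
- by move=> v h x; exact: cell_map_id.
- by move=> u v w h1 h2 h x; apply: cell_map_comp; apply/implyP => zu; exact: le_trans zu h1.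
Defined.

Section Composition.
Variables (M L K : pmod).

Definition phom_postcomp (g : phom L K) (f : phom M L) := phom_comp g f.
Fact phom_postcomp_linear g : linear (phom_postcomp g).
Proof. by move=> a f f'; apply: phom_ext => z x /=; rewrite linearP. Qed.
HB.instance Definition _ g :=
  GRing.isLinear.Build F (phom M L) (phom M K) *:%R
    (phom_postcomp g) (phom_postcomp_linear g).

Definition phom_precomp (f : phom M L) (g : phom L K) := phom_comp g f.
Fact phom_precomp_linear f : linear (phom_precomp f).
Proof. by move=> a g g'; apply: phom_ext. Qed.
HB.instance Definition _ f :=
  GRing.isLinear.Build F (phom L K) (phom M K) *:%R
    (phom_precomp f) (phom_precomp_linear f).

End Composition.

Section GlobalDual.
Local Notation F1 := (free1 (fun=> 1)).

Definition gdual (M : pmod) : pmod.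
Proof.
exists (fun z => phom M (shift F1 z) : lmodType F)
  (fun z w h => phom_postcomp (shift_map F1 h)
     : {linear phom M (shift F1 z) -> phom M (shift F1 w)}).
- by move=> z h f; apply: phom_ext => u x; exact: (@pm_id F1).
- by move=> u v w h1 h2 h f; apply: phom_ext => t x; exact: (pm_comp (addr_le t h1) (addr_le t h2) (addr_le t h)).
Defined.

Definition gdual_map M L (f : phom M L) : phom (gdual L) (gdual M).
Proof.
exists (fun z => phom_precomp f
     : {linear phom L (shift F1 z) -> phom M (shift F1 z)}).
by move=> z w h g; apply: phom_ext.
Defined.

End GlobalDual.

Definition pzero : pmod.
Proof.
exists (fun=> 'rV[F]_0 : lmodType F)
  (fun _ _ _ => idfun : {linear 'rV[F]_0 -> 'rV[F]_0}); by [].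
Defined.

Section DirectSum.
Variables M L : pmod.

Definition dsum_map z w (h : (z <= w)%O) (x : M z * L z) : M w * L w :=
  (pm_map M h x.1, pm_map L h x.2).
Fact dsum_map_linear z w h : linear (@dsum_map z w h).
Proof. by move=> a x y; congr pair; exact: linearP. Qed.
HB.instance Definition _ z w h :=
  GRing.isLinear.Build F (M z * L z)%type (M w * L w)%type *:%R
    (@dsum_map z w h) (dsum_map_linear h).

Definition dsum : pmod.
Proof.
exists (fun z => (M z * L z)%type : lmodType F) dsum_map.
- by move=> z h [x y]; rewrite /= /dsum_map !pm_id.
- by move=> u v w h1 h2 h [x y]; congr pair; exact: pm_comp.
Defined.

Definition inlv z (x : M z) : M z * L z := (x, 0).
Definition inrv z (x : L z) : M z * L z := (0, x).
Fact inlv_linear z : linear (@inlv z).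
Proof. by move=> a x y; congr pair; rewrite /= scaler0 addr0. Qed.
Fact inrv_linear z : linear (@inrv z).
Proof. by move=> a x y; congr pair; rewrite /= scaler0 addr0. Qed.
HB.instance Definition _ z :=
  GRing.isLinear.Build F (M z) (M z * L z)%type *:%R (@inlv z) (@inlv_linear z).
HB.instance Definition _ z :=
  GRing.isLinear.Build F (L z) (M z * L z)%type *:%R (@inrv z) (@inrv_linear z).

Definition dsum_inl : phom M dsum.
Proof.
exists (fun z => @inlv z : {linear M z -> (M z * L z)%type}) => z w h x.
by congr pair; rewrite /= linear0.
Defined.

Definition dsum_inr : phom L dsum.
Proof.
exists (fun z => @inrv z : {linear L z -> (M z * L z)%type}) => z w h x.
by congr pair; rewrite /= linear0.
Defined.

End DirectSum.

Definition free_sum (s : seq ZN) : pmod := foldr dsum pzero (map free1 s).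

Definition free_finite_rank (M : pmod) : Prop :=
  exists s : seq ZN, isomorphic M (free_sum s).

Lemma finite_dim_cell b : finite_dim (cell F b).
Proof.
case: b; last exact: finite_dim_row.
by exists 1%N, (fun=> 1) => v; exists (fun=> v); rewrite big_ord1 [RHS]mulr1.
Qed.

Lemma finite_dim_iso M L (f : phom M L) (g : phom L M) z :
  phom_comp g f = phom_id M -> finite_dim (L z) -> finite_dim (M z).
Proof.
move=> gf; have E t : g z (f z t) = t by rewrite -[RHS]/(phom_id M z t) -gf.
by apply: (@finite_dim_sub _ _ _ (f z)) => x y fxy; rewrite -(E x) fxy E.
Qed.

Lemma free_pfd M : free_finite_rank M -> pfd M.
Proof.
move=> [s [f [g [gf _]]]] z; apply: finite_dim_iso gf _.
elim: s {f g} => [|u s IHs]; first exact: finite_dim_row.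
exact: finite_dim_pair (finite_dim_cell _) IHs.
Qed.

Lemma finite_dim_hom_free1 u L : pfd L -> finite_dim (phom (free1 u) L).
Proof.
move=> L_fd; pose one v : free1 u v := @cell_map F true (u <= v)%O (1 : F).
have gen b (y : cell F b) : b -> exists a, y = a *: @cell_map F true b (1 : F).
  by case: b y => //= y _; exists y; rewrite [RHS]mulr1.
have gen0 b (y : cell F b) : ~~ b -> y = 0.
  by case: b y => //= y _; rewrite [y]thinmx0.
have one_map v (h : (u <= v)%O) : one v = pm_map (free1 u) h (one u).
  by apply: cell_map_comp; rewrite lexx.
pose ev (h : phom (free1 u) L) : L u := h u (one u).
have ev_lin : linear ev by [].
pose evl : {linear phom (free1 u) L -> L u} :=
  HB.pack ev (GRing.isLinear.Build F _ _ *:%R ev ev_lin).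
apply: (finite_dim_sub (f := evl)) (L_fd u) => h h' hh'.
apply: phom_ext => v y; have [uv|nuv] := boolP (u <= v)%O.
  have [a ->] := gen _ y uv.
  by rewrite -/(one v) (one_map v uv) !linearZ /= !phom_nat; congr (_ *: pm_map L uv _).
by have -> : y = 0 := gen0 _ y nuv; rewrite !linear0.
Qed.

Lemma finite_dim_hom_free_sum s L : pfd L -> finite_dim (phom (free_sum s) L).
Proof.
move=> L_fd; elim: s => [|u s IHs].
  exists 0%N, (fun=> 0) => h; exists (fun=> 0).
  by apply: phom_ext => z x; rewrite big_ord0 [x]thinmx0 linear0.
pose inl := dsum_inl (free1 u) (free_sum s).
pose inr := dsum_inr (free1 u) (free_sum s).
pose res (h : phom (free_sum (u :: s)) L) : phom (free1 u) L * phom (free_sum s) L :=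
  (phom_precomp inl h, phom_precomp inr h).
have res_lin : linear res by move=> a h h'; congr pair; exact: linearP.
pose resl : {linear phom (free_sum (u :: s)) L
                    -> (phom (free1 u) L * phom (free_sum s) L)%type} :=
  HB.pack res (GRing.isLinear.Build F _ _ *:%R res res_lin).
have h_fd := finite_dim_pair (finite_dim_hom_free1 u L_fd) IHs.
apply: (finite_dim_sub (f := resl)) h_fd => h h' hh'.
have hl := f_equal fst hh'; have hr := f_equal snd hh'.
apply: phom_ext => z [x y].
have -> : (x, y) = inl z x + inr z y :> free_sum (u :: s) z.
  by congr pair; rewrite /= ?addr0 ?add0r.
rewrite !linearD; congr (_ + _).
  exact: (f_equal (fun h : phom (free1 u) L => h z x) hl).
exact: (f_equal (fun h : phom (free_sum s) L => h z y) hr).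
Qed.

Lemma gdual_pfd M : free_finite_rank M -> pfd (gdual M).
Proof.
move=> [s [f [g [gf _]]]] z.
have fd_s : finite_dim (phom (free_sum s) (shift (free1 (fun=> 1)) z)).
  by apply: finite_dim_hom_free_sum => u; exact: finite_dim_cell.
apply: (finite_dim_sub (f := phom_precomp g)) fd_s => h h' hh'.
have E k : phom_comp (phom_comp k g) f = k :> phom M (shift (free1 (fun=> 1)) z).
  apply: phom_ext => u x /=; congr (k u _).
  exact: (f_equal (fun k : phom M M => k u x) gf).
by rewrite -(E h) -(E h'); congr phom_comp.
Qed.

(** The differential [C i -> C j] is indexed by a proof of [i = j + 1], so that
    its source and target need not be recomputed; such proofs are unique. *)
Record chain_complex := ChainComplex {
  ch_obj :> int -> pmod;
  ch_diff : forall i j : int, i = j + 1 -> phom (ch_obj i) (ch_obj j);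
  ch_diff2 : forall (i j k : int) (e : i = j + 1) (e' : j = k + 1) z x,
    ch_diff e' z (ch_diff e z x) = 0 }.

Record chain_map (C D : chain_complex) := ChainMap {
  ch_map :> forall i, phom (C i) (D i);
  ch_map_comm : forall (i j : int) (e : i = j + 1) z x,
    ch_map j z (ch_diff C e z x) = ch_diff D e z (ch_map i z x) }.

Record cochain_complex := CochainComplex {
  co_obj :> int -> pmod;
  co_diff : forall i j : int, j = i + 1 -> phom (co_obj i) (co_obj j);
  co_diff2 : forall (i j k : int) (e : j = i + 1) (e' : k = j + 1) z x,
    co_diff e' z (co_diff e z x) = 0 }.

Record cochain_map (C D : cochain_complex) := CochainMap {
  co_map :> forall i, phom (C i) (D i);
  co_map_comm : forall (i j : int) (e : j = i + 1) z x,
    co_map j z (co_diff C e z x) = co_diff D e z (co_map i z x) }.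

Arguments ch_diff2 : clear implicits.
Arguments ch_diff2 C {i j k} e e' z x : rename.
Arguments co_diff2 : clear implicits.
Arguments co_diff2 C {i j k} e e' z x : rename.

Definition int_pred_succ (d : int) : d = d - 1 + 1 := esym (subrK 1 d).

Definition chain_homology (d : int) (C : chain_complex) : pmod :=
  homology (ch_diff2 C (erefl (d + 1)) (int_pred_succ d)).

Definition chain_homology_map (d : int) (C D : chain_complex)
    (f : chain_map C D) : phom (chain_homology d C) (chain_homology d D) :=
  homology_map (ch_diff2 C (erefl (d + 1)) (int_pred_succ d))
    (ch_diff2 D (erefl (d + 1)) (int_pred_succ d))
    (ch_map_comm f (erefl (d + 1))) (ch_map_comm f (int_pred_succ d)).

Definition cohomology (d : int) (C : cochain_complex) : pmod :=
  homology (co_diff2 C (int_pred_succ d) (erefl (d + 1))).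

Definition cohomology_map (d : int) (C D : cochain_complex)
    (f : cochain_map C D) : phom (cohomology d C) (cohomology d D) :=
  homology_map (co_diff2 C (int_pred_succ d) (erefl (d + 1)))
    (co_diff2 D (int_pred_succ d) (erefl (d + 1)))
    (co_map_comm f (int_pred_succ d)) (co_map_comm f (erefl (d + 1))).

Definition gdual_complex (C : chain_complex) : cochain_complex.
Proof.
exists (fun i => gdual (C i)) (fun i j e => gdual_map (ch_diff C e)).
by move=> i j k e e' z f; apply: phom_ext => u x; rewrite /= ch_diff2 linear0.
Defined.

Definition gdual_chain_map (C D : chain_complex) (f : chain_map C D) :
  cochain_map (gdual_complex D) (gdual_complex C).
Proof.
exists (fun i => gdual_map (f i)) => i j e z g.
by apply: phom_ext => u x; rewrite /= ch_map_comm.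
Defined.

Definition eventually_vanishes (M : pmod) : Prop :=
  exists b : ZN, forall z : ZN, (exists x : M z, x <> 0) -> (z <= b)%O.

Lemma cohomology_gdual_pfd (d : int) (C : chain_complex) :
  (forall i, free_finite_rank (C i)) -> pfd (cohomology d (gdual_complex C)).
Proof. by move=> C_free; apply: homology_pfd; exact: gdual_pfd. Qed.

Lemma chain_homology_pfd (d : int) (C : chain_complex) :
  (forall i, free_finite_rank (C i)) -> pfd (chain_homology d C).
Proof. by move=> C_free; apply: homology_pfd; exact: free_pfd. Qed.

End PersistenceModules.

(* Main.v *)
Require Import Defs.
From HB Require Import structures.
From mathcomp Require Import all_boot all_order all_algebra.
From mathcomp Require Import boolp functions.

(** For a convex set [P] of grades let [k_P] be [F] at the grades of [P] and zero
    elsewhere, with identities inside [P]. The global dual of [M] at [z] is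
    [Hom(M, k_P)] for [P] the grades [v] with [0 < z i + v i] for all [i],
    while [Hom(M, k_P)] for [P] the grades [v <= - z] is the space of linear
    forms on [M (- z)], because such a morphism is determined by its value at the
    largest grade of [P]. The duality exchanges these two intervals one
    coordinate at a time.

    Let [P] be a box, with each coordinate of [z + v] required to be positive,
    required to be nonpositive, or free. If coordinate [i] is free, cutting [P]
    at [z i + v i = 0] gives an upper part [A] and a lower part [B], and
    [0 -> k_A -> k_P -> k_B -> 0] is exact. As [C] is free, [Hom(C, -)] keeps it
    exact ([extend_lower]), and the connecting homomorphism
    [H^n Hom(C, k_B) -> H^(n+1) Hom(C, k_A)] is an isomorphism as soon as
    [Hom(C, k_P)] is acyclic in degrees [n] and [n + 1]. Composing over all [N]
    coordinates goes from [H^d] of the dual of [C (- z)], which is the dual of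
    [H_d(C)] at [- z], to [H^(d + N)] of the global dual.

    The acyclicity ([acyclic_box]) holds in degree [d + k] for every box with a
    free coordinate and at most [k] coordinates required to be positive, where
    [k <= N]. Without positive coordinates, a cocycle of [Hom(C, k_P)] amounts to
    one of the dual of [C] at a grade [p] of [P] whose free coordinates are large;
    there homology vanishes, since exceeding the bound of its support in a single
    coordinate is enough ([acyclic_down_box]). Each positive coordinate is then
    removed by the exact sequence above, at the price of one degree.

    Connecting homomorphisms are handled as linear relations between cocycles
    ([step], [zigzag]): a lift along [k_P -> k_B] is not canonical, but the
    relation formed by all lifts visibly commutes with chain maps and with
    changes of [z]. The composite relation between linear forms on homology and
    global cohomology classes ([corresponds]) is total, functional, injective and
    surjective, so it is the graph of the natural isomorphism. *)

Set Implicit Arguments.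
Unset Strict Implicit.
Unset Printing Implicit Defensive.

Import Order.TTheory GRing.Theory Num.Theory.
Local Open Scope ring_scope.

(** * Linear relations and linear forms on vector spaces *)

Section LinearRelations.
Variables (F : fieldType) (V W : lmodType F) (R : V -> W -> Prop).
Hypothesis R_lin : forall a x x' y y',
  R x y -> R x' y' -> R (a *: x + x') (a *: y + y').
Hypothesis R_fun0 : forall y, R 0 y -> y = 0.

Lemma rel_functional x y y' : R x y -> R x y' -> y = y'.
Proof.
move=> xy xy'; have := R_lin (-1) xy xy'.
rewrite !scaleN1r addNr => /R_fun0 /eqP.
by rewrite addrC subr_eq0 => /eqP.
Qed.

Lemma linear_of_rel : (forall x, exists y, R x y) ->
  exists f : {linear V -> W}, forall x, R x (f x).
Proof.
move=> /choice[f Rf].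
have f_lin : linear f.
  by move=> a x y; apply: rel_functional (Rf _) (R_lin _ (Rf x) (Rf y)).
pose fl : {linear V -> W} := HB.pack f (GRing.isLinear.Build F V W *:%R f f_lin).
by exists fl.
Qed.

End LinearRelations.

Section FactorForm.
Variable F : fieldType.
Implicit Types V W : lmodType F.

Lemma factor_form_surj V W (g : {linear V -> W}) (phi : {linear V -> F^o}) :
  (forall w, exists v, g v = w) -> (forall x, g x = 0 -> phi x = 0) ->
  exists psi : {linear W -> F^o}, forall x, psi (g x) = phi x.
Proof.
move=> g_surj phi0.
pose R (w : W) (c : F^o) := exists2 v, g v = w & phi v = c.
have R_lin a w w' c c' : R w c -> R w' c' -> R (a *: w + w') (a *: c + c').
  by move=> [v <- <-] [v' <- <-]; exists (a *: v + v'); rewrite linearP.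
have R_fun0 c : R 0 c -> c = 0 by move=> [v /phi0 <-].
have R_tot w : exists c, R w c by have [v gv] := g_surj w; exists (phi v), v.
have [psi Rpsi] := linear_of_rel R_lin R_fun0 R_tot.
by exists psi => x; apply: (rel_functional R_lin R_fun0 (Rpsi _)); exists x.
Qed.

(** Adjoining one vector [w] to the image of [g]: the value [c] of the form at [w]
    is forced when [w] is already in the image, and arbitrary otherwise. *)
Lemma factor_form_step V W (g : {linear V -> W}) (phi : {linear V -> F^o})
    (w : W) : (forall x, g x = 0 -> phi x = 0) ->
  exists c : F, forall x a, g x + a *: w = 0 -> phi x + a * c = 0.
Proof.
move=> phi0; have [[v gv]|nv] := pselect (exists v, g v = w).
  exists (phi v) => x a; rewrite -gv -linearZ -linearD => /phi0.
  by rewrite linearD linearZ.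
exists 0 => x a; rewrite mulr0 addr0 => gx; apply: phi0.
have [a0|a_neq0] := eqVneq a 0; first by rewrite a0 scale0r addr0 in gx.
case: nv; exists (- (a^-1 *: x)); apply: (scalerI a_neq0).
rewrite linearN linearZ scalerN scalerA divff // scale1r.
by apply/esym/eqP; rewrite -addr_eq0 addrC gx.
Qed.

(** Duality is exact: a form on [V] that kills the kernel of [g] comes from a form
    on [W]. The source of [g] is enlarged by one generator of [W] at a time, so
    that no basis of [W] has to be chosen. *)
Lemma factor_form V W (g : {linear V -> W}) (phi : {linear V -> F^o}) :
  finite_dim W -> (forall x, g x = 0 -> phi x = 0) ->
  exists psi : {linear W -> F^o}, forall x, psi (g x) = phi x.
Proof.
move=> [n [b bW]].
have {bW} : forall w, exists v (a : 'I_n -> F), w = g v + \sum_i a i *: b i.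
  by move=> w; have [a ->] := bW w; exists 0, a; rewrite linear0 add0r.
elim: n V g phi b => [|n IHn] V g phi b gb phi0.
  apply: factor_form_surj phi0 => w.
  by have [v [a ->]] := gb w; exists v; rewrite big_ord0 addr0.
have [c phic] := factor_form_step (b ord0) phi0.
pose g' (v : V * F^o) : W := g v.1 + v.2 *: b ord0.
have g'_lin : linear g'.
  move=> a [x y] [x' y']; rewrite /g' /= linearP scalerDr scalerDl scalerA.
  by rewrite addrACA.
pose phi' (v : V * F^o) : F^o := phi v.1 + v.2 *: (c : F^o).
have phi'_lin : linear phi'.
  move=> a [x y] [x' y']; rewrite /phi' /= linearP scalerDr scalerDl scalerA.
  by rewrite addrACA.
pose gl : {linear (V * F^o)%type -> W} :=
  HB.pack g' (GRing.isLinear.Build F _ _ *:%R g' g'_lin).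
pose phil : {linear (V * F^o)%type -> F^o} :=
  HB.pack phi' (GRing.isLinear.Build F _ _ *:%R phi' phi'_lin).
have [|v /phic //|psi psig] := IHn _ gl phil (fun i => b (lift ord0 i)).
  move=> w; have [v [a ->]] := gb w; exists (v, a ord0), (fun i => a (lift ord0 i)).
  by rewrite big_ord_recl addrA.
exists psi => x; have := psig (x, 0).
by rewrite /= /g' /phi' /= !scale0r !addr0.
Qed.

End FactorForm.

(** * Morphisms to interval modules *)

Section Forms.
Variables (F : fieldType) (N : nat).
Local Notation ZN := ('I_N -> int).
Implicit Types (M L K : pmod F N) (P Q : pred ZN).

(** Morphisms from [M] to the interval modules of different sets [P] all live in
    this one type: a value in [F] at a grade outside [P] is required to be zero.
    Inclusions of interval modules then become identities, and quotients become
    truncations [restr]. *)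
Definition forms M := forall v, {linear M v -> F^o}.

Lemma forms_ext M (f g : forms M) : (forall v x, f v x = g v x) -> f = g.
Proof.
by move=> fg; apply: functional_extensionality_dep => v; exact/linear_ext/(fg v).
Qed.

(** Naturality of a morphism from [M] to the interval module of [P]. When [v] is
    outside [P] and [w] inside, the equation says that the image of [M v] in [M w]
    is killed, as it must be. *)
Definition hom_to P M (f : forms M) : Prop :=
  (forall v x, ~~ P v -> f v x = 0) /\
  (forall v w (h : (v <= w)%O) x, P w -> f w (pm_map M h x) = f v x).

Definition comb M (a : F) (f g : forms M) : forms M :=
  fun v => (a \*: f v) \+ g v.
Definition pull M L (p : phom M L) (f : forms L) : forms M :=
  fun v => f v \o p v.
Definition restr M Q (f : forms M) : forms M :=
  fun v => if Q v then f v else \0.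

Lemma restrE M Q (f : forms M) v x : restr Q f v x = if Q v then f v x else 0.
Proof. by rewrite /restr; case: (Q v). Qed.

Lemma hom_to_comb P M a (f g : forms M) :
  hom_to P f -> hom_to P g -> hom_to P (comb a f g).
Proof.
move=> [f0 fP] [g0 gP]; split=> [v x nP|v w h x Pw] /=.
  by rewrite f0 // g0 // scaler0 addr0.
by rewrite fP // gP.
Qed.

Lemma hom_to_pull P M L (p : phom M L) (f : forms L) :
  hom_to P f -> hom_to P (pull p f).
Proof.
move=> [f0 fP]; split=> [v x nP|v w h x Pw] /=; first by rewrite f0.
by rewrite phom_nat fP.
Qed.

(** The hypothesis is what makes the maps that are the identity on the common
    grades a morphism from the interval module of [P] to that of [Q]. *)
Lemma hom_to_restr P Q M (f : forms M) :
  (forall u v, (u <= v)%O -> P u -> Q v -> Q u && P v) ->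
  hom_to P f -> hom_to Q (restr Q f).
Proof.
move=> PQ [f0 fP]; split=> [v x nQ|v w h x Qw]; first by rewrite restrE (negbTE nQ).
rewrite !restrE Qw; have [Pv|nPv] := boolP (P v).
  by have /andP[-> Pw] := PQ _ _ h Pv Qw; exact: fP.
rewrite (f0 v) // if_same.
have [Pw|nPw] := boolP (P w); last exact: f0.
by rewrite fP ?f0.
Qed.

Lemma restr_id P M (f : forms M) : hom_to P f -> restr P f = f.
Proof.
move=> [f0 _]; apply: forms_ext => v x; rewrite restrE.
by case: ifPn => // /f0 ->.
Qed.

(** A morphism to the interval module of [P] is determined at [p] if [M p] reaches
    all of [M w] at enough grades [w] beyond those of [P]. *)
Lemma hom_to_eq0 P M (f : forms M) p : P p ->
  (forall v, P v -> exists w (h : (v <= w)%O) (k : (p <= w)%O),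
     P w /\ forall y : M w, exists x, pm_map M k x = y) ->
  hom_to P f -> (forall x, f p x = 0) -> forall v x, f v x = 0.
Proof.
move=> Pp Psurj [f0 fP] fp v x; have [Pv|/f0 -> //] := boolP (P v).
have [w [h [k [Pw /(_ (pm_map M h x))[y hx]]]]] := Psurj v Pv.
by rewrite -(fP _ _ h x Pw) -hx fP.
Qed.

Section LowerPart.
Variables (P L : pred ZN) (M : pmod F N).
Hypothesis L_down : forall u v, (u <= v)%O -> L v -> L u.

Lemma hom_to_lower (f : forms M) :
  hom_to P f -> hom_to (predI P L) (restr (predI P L) f).
Proof.
apply: hom_to_restr => u v uv Pu /= /andP[Pv Lv].
by rewrite Pu Pv (L_down uv Lv).
Qed.

Lemma hom_to_upper (f : forms M) : hom_to P f ->
  (forall v x, P v -> L v -> f v x = 0) -> hom_to (predD P L) f.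
Proof.
move=> [f0 fP] fL; split=> [v x|v w h x /= /andP[_ /fP //]].
rewrite /= negb_and negbK; have [Pv /orP[Lv|//]|/f0 -> //] := boolP (P v).
exact: fL.
Qed.

Lemma hom_to_of_upper (f : forms M) : hom_to (predD P L) f -> hom_to P f.
Proof.
move=> [f0 fP]; split=> [v x nP|v w h x Pw].
  by rewrite f0 //= (negbTE nP) andbF.
have [Lw|nLw] := boolP (L w); last by apply: fP; rewrite /= nLw.
by rewrite !f0 //= ?Lw ?(L_down h Lw).
Qed.

End LowerPart.

(** Morphisms to the interval module of the grades below [p] are the linear forms
    on [M p]: that module is injective. *)
Lemma hom_to_point M p (psi : {linear M p -> F^o}) :
  exists2 f : forms M, hom_to (fun v => (v <= p)%O) f & forall x, f p x = psi x.
Proof.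
pose f v : {linear M v -> F^o} :=
  if @idP (v <= p)%O is ReflectT h then psi \o pm_map M h else \0.
have fE v (h : (v <= p)%O) x : f v x = psi (pm_map M h x).
  by rewrite /f; case: {-}_ / idP => [h'|//]; rewrite (bool_irrelevance h h').
exists f => [|x]; last by rewrite (fE _ (lexx p)) pm_id.
split=> [v x /negP nvp|v w h x wp]; first by rewrite /f; case: {-}_ / idP.
by rewrite (fE _ wp) (fE _ (le_trans h wp)) (pm_comp h wp).
Qed.

End Forms.

(** * Extension of morphisms on free modules *)

Section FreeModules.
Variables (F : fieldType) (N : nat).
Local Notation ZN := ('I_N -> int).
Implicit Types (M L K : pmod F N) (P Q : pred ZN).

Definition convex P := forall u v w : ZN,
  (u <= v)%O -> (v <= w)%O -> P u -> P w -> P v.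

(** This contains projectivity, when [P] is cut into two parts, and, when [Q] is the
    set of grades below some [p] in [P], the extension of a linear form on [M p]. *)
Definition extends_forms M := forall P Q (f : forms M), convex P ->
  (forall v, Q v -> P v) -> hom_to Q f ->
  exists2 h, hom_to P h & forall v x, Q v -> h v x = f v x.

(** Going from [p] to [w] meets no new generator of [M] when the coordinates that
    change are already beyond all generators. *)
Definition generated_below (b : ZN) M := forall p w (h : (p <= w)%O),
  (forall i, p i = w i \/ b i <= p i) ->
  forall y : M w, exists x, pm_map M h x = y.

Lemma phom_cancel M L (i : phom M L) (r : phom L M) z x :
  phom_comp r i = phom_id M -> r z (i z x) = x.
Proof. by move=> ri; rewrite -[RHS]/(phom_id M z x) -ri. Qed.

Lemma extends_forms_retract M L (i : phom M L) (r : phom L M) :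
  phom_comp r i = phom_id M -> extends_forms L -> extends_forms M.
Proof.
move=> ri extL P Q f cP QP /(hom_to_pull r) /(extL P Q _ cP QP)[h hP hf].
exists (pull i h) => [|v x Qv]; first exact: hom_to_pull.
by rewrite /= hf //= (phom_cancel x ri).
Qed.

Lemma generated_below_retract b M L (i : phom M L) (r : phom L M) :
  phom_comp r i = phom_id M -> generated_below b L -> generated_below b M.
Proof.
move=> ri genL p w h pw y; have [x xE] := genL p w h pw (i w y).
by exists (r p x); rewrite -phom_nat xE (phom_cancel y ri).
Qed.

Lemma extends_forms_zero : extends_forms (pzero F N).
Proof.
move=> P Q f _ _ _; exists (fun=> \0) => [|v x _]; first by split.
by rewrite [x]thinmx0 !linear0.
Qed.

Lemma extends_forms_dsum M L :
  extends_forms M -> extends_forms L -> extends_forms (dsum M L).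
Proof.
move=> extM extL P Q f cP QP fQ.
have [h hP hf] := extM P Q _ cP QP (hom_to_pull (dsum_inl M L) fQ).
have [k kP kf] := extL P Q _ cP QP (hom_to_pull (dsum_inr M L) fQ).
pose hk v : {linear dsum M L v -> F^o} := (h v \o fst) \+ (k v \o snd).
exists hk => [|v [x y] Qv].
  case: hP kP => [h0 hP] [k0 kP].
  split=> [v x nP|v w vw x Pw] /=; first by rewrite h0 // k0 // addr0.
  by rewrite hP // kP.
rewrite /= hf // kf //= -linearD; congr (f v _).
by congr pair; rewrite /= ?addr0 ?add0r.
Qed.

Definition cell_form b : {linear cell F b -> F^o} :=
  (@cell_map F b true : {linear cell F b -> cell F true}).

Definition form_cell b : {linear F^o -> cell F b} :=
  (@cell_map F true b : {linear cell F true -> cell F b}).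

(** The extension is the multiple of the canonical form on [free1 F u] by the value
    [c] of [f] at the generator. If [u] is outside [Q], then [c = 0] and the
    extension is zero, which is still correct on [Q]. *)
Lemma extends_forms_free1 u : extends_forms (free1 F u).
Proof.
move=> P Q f cP QP [f0 fQ].
pose one v : free1 F u v := form_cell (u <= v)%O 1.
have gen v (x : free1 F u v) : (u <= v)%O -> exists a, x = a *: one v.
  rewrite /one; move: x; rewrite /free1 /=; case: (u <= v)%O => //= x _.
  by exists x; rewrite [RHS]mulr1.
have gen0 v (x : free1 F u v) : ~~ (u <= v)%O -> x = 0.
  by move: x; rewrite /free1 /=; case: (u <= v)%O => //= x _; rewrite [x]thinmx0.
have one_map v w (uv : (u <= v)%O) (h : (v <= w)%O) :
    pm_map (free1 F u) h (one v) = one w.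
  by apply/esym/cell_map_comp; rewrite uv.
have one_val v : (u <= v)%O -> cell_form (u <= v)%O (one v) = 1.
  by rewrite /one => ->.
pose c := f u (one u).
pose h v : {linear free1 F u v -> F^o} :=
  (c : F) \*: cell_form (u <= v)%O.
have hE v a : (u <= v)%O -> h v (a *: one v) = a *: c.
  by move=> uv; rewrite linearZ /= one_val // [c *: 1]mulr1.
exists (restr P h) => [|v x Qv].
  split=> [v x /negbTE nP|v w vw x Pw]; first by rewrite restrE nP.
  rewrite !restrE Pw; have [uv|nuv] := boolP (u <= v)%O; last first.
    by rewrite (gen0 v x nuv) !linear0 if_same.
  have [a ->] := gen v x uv; rewrite linearZ one_map // !hE ?(le_trans uv) //.
  case: ifPn => // nPv; suff -> : c = 0 by rewrite scaler0.
  apply: f0; apply: contra nPv => /QP Pu; exact: cP uv vw Pu Pw.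
rewrite restrE QP //; have [uv|nuv] := boolP (u <= v)%O; last first.
  by rewrite (gen0 v x nuv) !linear0.
by have [a ->] := gen v x uv; rewrite hE // linearZ -(one_map u v (lexx u) uv) fQ.
Qed.

Lemma free_extends_forms M : free_finite_rank M -> extends_forms M.
Proof.
move=> [s [f [g [gf _]]]]; apply: (extends_forms_retract gf) => {f g gf}.
elim: s => [|u s IHs]; first exact: extends_forms_zero.
exact: extends_forms_dsum (extends_forms_free1 (u := u)) IHs.
Qed.

Lemma generated_below_le b c M :
  (b <= c)%O -> generated_below b M -> generated_below c M.
Proof.
move=> /lefP bc genM p w h pw; apply: genM => i.
by have [|cp] := pw i; [left | right; apply: le_trans (bc i) cp].
Qed.

Lemma generated_below_free1 u : generated_below u (free1 F u).
Proof.
move=> p w h pw y; have [uw|nuw] := boolP (u <= w)%O; last first.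
  exists 0; rewrite linear0; move: y nuw; rewrite /free1 /=.
  by case: (u <= w)%O => // y _; rewrite [y]thinmx0.
have up : (u <= p)%O.
  apply/lefP => i; have [->|//] := pw i; exact/lefP.
exists (@cell_map F (u <= w)%O (u <= p)%O y).
apply: etrans (esym (cell_map_comp _ _ _)) (cell_map_id _).
by rewrite up implybT.
Qed.

Lemma free_generated_below M :
  free_finite_rank M -> exists b, generated_below b M.
Proof.
move=> [s [f [g [gf _]]]].
suff [b genb] : exists b, generated_below b (free_sum F s).
  by exists b; apply: generated_below_retract gf genb.
elim: s {f g gf} => [|u s [b IHb]].
  by exists 0 => p w h _ y; exists 0; rewrite linear0 [y]thinmx0.
pose c i := Order.max (u i) (b i).
have uc : (u <= c)%O by apply/lefP => i; rewrite le_max lexx.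
have bc : (b <= c)%O by apply/lefP => i; rewrite le_max lexx orbT.
exists c => p w h pw [y y'].
have [x xy] := generated_below_le uc (@generated_below_free1 u) h pw y.
have [x' xy'] := generated_below_le bc IHb h pw y'.
by exists (x, x'); congr pair.
Qed.

End FreeModules.

(** * Connecting relations of the complexes of forms *)

Section FormComplex.
Variables (F : fieldType) (N : nat) (C : chain_complex F N).
Local Notation ZN := ('I_N -> int).
Implicit Types P L : pred ZN.

Definition cocycle P n (f : forms (C n)) : Prop :=
  hom_to P f /\ forall m (e : m = n + 1) v x, f v (ch_diff C e v x) = 0.

Definition coboundary P n (f : forms (C n)) : Prop :=
  exists j (e : n = j + 1) (g : forms (C j)),
    hom_to P g /\ f = pull (ch_diff C e) g.

Definition acyclic P n : Prop :=
  forall f : forms (C n), cocycle P f -> coboundary P f.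

(** The index [m] is determined by [n], so one differential suffices. *)
Lemma cocycleI P m n (e : m = n + 1) (f : forms (C n)) :
  hom_to P f -> (forall v x, f v (ch_diff C e v x) = 0) -> cocycle P f.
Proof. by move=> fP f0; split=> // m' e'; subst m; subst m'. Qed.

Lemma coboundaryE P n j (e : n = j + 1) (f : forms (C n)) : coboundary P f ->
  exists2 g : forms (C j), hom_to P g & f = pull (ch_diff C e) g.
Proof.
move=> [j' [e' [g [gP fE]]]].
have jj' : j' = j by apply: (addIr 1); rewrite -e' -e.
by subst j'; exists g; rewrite // fE (eq_irrelevance e' e).
Qed.

Lemma cocycle_pull P m n (e : m = n + 1) (f : forms (C n)) :
  hom_to P f -> cocycle P (pull (ch_diff C e) f).
Proof.
move=> fP; split=> [|k e' v x]; first exact: hom_to_pull.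
by rewrite /= ch_diff2 linear0.
Qed.

Hypothesis C_free : forall i, free_finite_rank (C i).

Section Step.
Variables P L : pred ZN.
Hypothesis P_convex : convex P.
Hypothesis L_down : forall u v : ZN, (u <= v)%O -> L v -> L u.

(** Exactness of [Hom(C, -)] on the right, from freeness. *)
Lemma extend_lower n (f : forms (C n)) : hom_to (predI P L) f ->
  exists2 h, hom_to P h & restr (predI P L) h = f.
Proof.
move=> fPL; have [|h hP hf] := free_extends_forms (C_free n) P_convex _ fPL.
  by move=> v /andP[].
exists h => //; apply: forms_ext => v x; rewrite restrE.
by case: ifPn => [/hf //|nPL]; case: fPL => f0 _; rewrite f0.
Qed.

(** The connecting homomorphism for the parts of [P] inside and outside [L], as a
    relation: [h] lifts [f], and its coboundary vanishes on the lower part when [f]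
    is a cocycle. *)
Definition step j n (e : n = j + 1) (f : forms (C j)) (g : forms (C n)) : Prop :=
  exists h, [/\ hom_to P h, restr (predI P L) h = f & pull (ch_diff C e) h = g].

Lemma step_comb j n (e : n = j + 1) a f f' g g' :
  step e f g -> step e f' g' -> step e (comb a f f') (comb a g g').
Proof.
move=> [h [hP <- <-]] [h' [hP' <- <-]]; exists (comb a h h').
split; first exact: hom_to_comb.
  apply: forms_ext => v x; rewrite /= !restrE /=.
  by case: ifP; rewrite // scaler0 addr0.
exact: forms_ext.
Qed.

Lemma step_cocycle j n (e : n = j + 1) f g :
  cocycle (predI P L) f -> step e f g -> cocycle (predD P L) g.
Proof.
move=> [_ f0] [h [hP hf <-]].
have [gP g0] := cocycle_pull e hP; split=> //; apply: hom_to_upper => // v x Pv Lv.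
have := f0 _ e v x; rewrite -hf restrE /= Pv Lv; exact.
Qed.

Lemma step_total j n (e : n = j + 1) f :
  cocycle (predI P L) f -> exists g, step e f g.
Proof.
move=> [/extend_lower[h hP hf] _].
by exists (pull (ch_diff C e) h), h.
Qed.

(** If [f] is the coboundary of [k], and [k'] extends [k], then subtracting the
    coboundary of [k'] from the lift [h] does not change [g] and leaves a cochain
    supported on the upper part. *)
Lemma step_coboundary j n (e : n = j + 1) f g :
  step e f g -> coboundary (predI P L) f -> coboundary (predD P L) g.
Proof.
move=> [h [hP hf <-]] [i [e' [k [/extend_lower[k' k'P <-] fE]]]].
exists j, e, (comb (-1) (pull (ch_diff C e') k') h); split.
  apply: hom_to_upper => [|v x Pv Lv].
    by apply: hom_to_comb; first exact: hom_to_pull.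
  have /(f_equal (fun f : forms (C j) => f v x)) : restr (predI P L) h =
    pull (ch_diff C e') (restr (predI P L) k') by rewrite hf.
  by rewrite /= !restrE /= Pv Lv /= => ->; rewrite scaleN1r addNr.
by apply: forms_ext => v x; rewrite /= ch_diff2 linear0 scaler0 add0r.
Qed.

(** If [g] is the coboundary of [k], then [h - k] is a cocycle on [P], hence the
    coboundary of some [l], and on the lower part it restricts to [f]. *)
Lemma step_coboundary_inv j n (e : n = j + 1) f g : acyclic P j ->
  step e f g -> coboundary (predD P L) g -> coboundary (predI P L) f.
Proof.
move=> acP [h [hP <- <-]] /(coboundaryE e)[k kA hk].
have kP := hom_to_of_upper L_down kA.
have /acP[i [e' [l [lP lE]]]] : cocycle P (comb (-1) k h).
  apply: (cocycleI (e := e)) => [|v x]; first exact: hom_to_comb.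
  have /(f_equal (fun f : forms (C n) => f v x)) /= -> := hk.
  by rewrite scaleN1r addNr.
exists i, e', (restr (predI P L) l); split; first exact: hom_to_lower.
apply: forms_ext => v x; rewrite /= !restrE.
case: ifPn => // /andP[Pv Lv].
have /(f_equal (fun f : forms (C j) => f v x)) /= <- := lE.
by case: kA => k0 _; rewrite k0 /= ?Lv // scaler0 add0r.
Qed.

(** A cocycle on the upper part is one on [P]; as such it is the coboundary of some
    [h], and the truncation of [h] is the required [f]. *)
Lemma step_onto j n (e : n = j + 1) g : acyclic P n ->
  cocycle (predD P L) g -> exists2 f, cocycle (predI P L) f & step e f g.
Proof.
move=> acP [gA g0].
have /acP/(coboundaryE e)[h hP gE] : cocycle P g.
  by split=> //; exact: hom_to_of_upper gA.
exists (restr (predI P L) h); last by exists h.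
apply: (cocycleI (e := e)) => [|v x]; first exact: hom_to_lower.
rewrite restrE; case: ifPn => // /andP[Pv Lv].
have /(f_equal (fun f : forms (C n) => f v x)) /= <- := gE.
by case: gA => gA0 _; rewrite gA0 //= Lv.
Qed.

Lemma acyclic_upper j n : n = j + 1 ->
  acyclic P n -> acyclic (predI P L) j -> acyclic (predD P L) n.
Proof.
move=> e acP acB g /(step_onto e acP)[f fc fg].
exact: step_coboundary fg (acB f fc).
Qed.

End Step.

End FormComplex.

(** * Boxes *)

Section Boxes.
Variable N : nat.
Local Notation ZN := ('I_N -> int).
Implicit Types (s : 'I_N -> option bool) (z : ZN) (i : 'I_N) (t : seq 'I_N).

(** [Some true], [Some false] and [None] mean positive, nonpositive and free. *)
Definition constrained (o : option bool) (a : int) : bool :=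
  if o is Some b then (0 < a) == b else true.

Definition box s z : pred ZN :=
  fun v => [forall i, constrained (s i) (z i + v i)].

Definition low i z : pred ZN := fun v => ~~ (0 < z i + v i).

Definition upd s i o : 'I_N -> option bool := fun j => if j == i then o else s j.

Definition mark t s : 'I_N -> option bool :=
  fun j => if j \in t then Some true else s j.

Lemma box_upd s i o z v :
  box (upd s i o) z v = box (upd s i None) z v && constrained o (z i + v i).
Proof.
rewrite /upd; apply/forallP/andP => [sv|[/forallP sv ov] j].
  split; last by have := sv i; rewrite eqxx.
  by apply/forallP => j; have := sv j; case: (j == i).
by have := sv j; case: (eqVneq j i) => [->|].
Qed.

Lemma box_lower s i z :
  predI (box (upd s i None) z) (low i z) = box (upd s i (Some false)) z :> pred ZN.
Proof.
by apply: functional_extensionality_dep => v; rewrite box_upd /= eqbF_neg.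
Qed.

Lemma box_upper s i z :
  predD (box (upd s i None) z) (low i z) = box (upd s i (Some true)) z :> pred ZN.
Proof.
apply: functional_extensionality_dep => v.
by rewrite box_upd /= /low negbK eqb_id andbC.
Qed.

Lemma mark_cons i t s : mark (i :: t) s = upd (mark t s) i (Some true).
Proof.
apply: functional_extensionality_dep => j; rewrite /mark /upd in_cons.
by case: (j == i).
Qed.

Lemma upd_mark i t s o : i \notin t -> upd (mark t s) i o = mark t (upd s i o).
Proof.
move=> it; apply: functional_extensionality_dep => j; rewrite /mark /upd.
by case: (eqVneq j i) => [->|//]; rewrite (negbTE it).
Qed.

Lemma upd_id s i : upd s i (s i) = s.
Proof.
apply: functional_extensionality_dep => j; rewrite /upd.
by case: eqVneq => [->|].
Qed.

Lemma constrained_convex o (a b c : int) : a <= b -> b <= c ->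
  constrained o a -> constrained o c -> constrained o b.
Proof.
case: o => // -[] /= ab bc; rewrite ?eqb_id ?eqbF_neg -?leNgt => oa oc.
  exact: lt_le_trans oa ab.
exact: le_trans bc oc.
Qed.

Lemma box_convex s z : convex (box s z).
Proof.
move=> u v w /lefP uv /lefP vw /forallP su /forallP sw; apply/forallP => i.
by apply: constrained_convex (su i) (sw i); rewrite lerD2l.
Qed.

Lemma low_down i z u v : (u <= v)%O -> low i z v -> low i z u.
Proof.
by move=> /lefP uv; rewrite /low -!leNgt; apply: le_trans; rewrite lerD2l.
Qed.

End Boxes.

(** * Vanishing of the cohomology of boxes with a free coordinate *)

Section Acyclicity.
Variables (F : fieldType) (N : nat) (C : chain_complex F N).
Local Notation ZN := ('I_N -> int).
Hypothesis C_free : forall i, free_finite_rank (C i).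

(** The two indices next to [n] are arbitrary here so that the lemma applies to
    any differentials of [C] around degree [n]. *)
Lemma cycle_boundary m n j (e : m = n + 1) (e' : n = j + 1) (p : ZN) :
  (forall q : chain_homology n C p, q = 0) ->
  forall x : C n p, ch_diff C e' p x = 0 -> exists y, ch_diff C e p y = x.
Proof.
move=> H0 x; subst m; have jn : j = n - 1 by rewrite e' addrK.
subst j; rewrite (eq_irrelevance e' (int_pred_succ n)) => /eqP xK.
pose lift := pker_lift (@ch_diff2 _ _ C _ _ _ (erefl (n + 1)) (int_pred_succ n)) p.
have : cokerv_pi lift (Kerv xK) = cokerv_pi lift 0.
  by rewrite [LHS]H0 [RHS]H0.
by move=> /cokerv_eqP[y]; rewrite subr0 => /(f_equal val) /= <-; exists y.
Qed.

(** The free coordinates of the grade [p] are chosen beyond the bounds of the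
    generators of [C n] and of the support of the homology. A cocycle [f] is then
    determined by the form [f p], which kills the cycles since they are boundaries,
    so it factors through the differential; the factor [psi] extends to [g]. *)
Lemma acyclic_down_box n (s : 'I_N -> option bool) (z : ZN) :
  eventually_vanishes (chain_homology n C) ->
  (forall i, s i != Some true) -> (exists i, s i = None) ->
  acyclic C (box s z) n.
Proof.
move=> [b Hb] s_down [i0 si0] f [fP f0].
have [c genc] := free_generated_below (C_free n).
pose p : ZN := fun i => if s i is None then Order.max (b i + 1) (c i) else - z i.
have Pp : box s z p.
  apply/forallP => i; rewrite /p; move: (s_down i).
  by case: (s i) => [[]|] //= _; rewrite subrr.
have P_down u v : (u <= v)%O -> box s z v -> box s z u.
  move=> /lefP uv /forallP sv; apply/forallP => i; have := sv i.
  move: (s_down i); case: (s i) => [[]|] //= _; rewrite !eqbF_neg -!leNgt.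
  by apply: le_trans; rewrite lerD2l.
have H0 (q : chain_homology n C p) : q = 0.
  apply: contrapT => q0; have /lefP/(_ i0) : (p <= b)%O by apply: Hb; exists q.
  by rewrite /p si0 ge_max leNgt ltzD1 lexx.
have nE := int_pred_succ n.
have [psi psiE] : exists psi : {linear C (n - 1) p -> F^o},
    forall x, psi (ch_diff C nE p x) = f p x.
  apply: factor_form => [|x /(cycle_boundary (erefl (n + 1)) H0)[y <-]].
    exact: free_pfd.
  exact: f0.
have [g0 g0p g0E] := hom_to_point psi.
have [g gP gE] := free_extends_forms (C_free (n - 1)) (@box_convex _ s z)
  (fun v vp => P_down _ _ vp Pp) g0p.
exists (n - 1), nE, g; split=> //; apply: forms_ext => v x.
suff /(_ v x) : forall v x, comb (-1) (pull (ch_diff C nE) g) f v x = 0.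
  by rewrite /= scaleN1r addrC => /eqP; rewrite subr_eq0 => /eqP.
apply: (@hom_to_eq0 _ _ (box s z) _ _ p) => // [u Pu||y].
(* Above [u] and [p], with the nonpositive coordinates of [p] unchanged. *)
- pose w i := Order.max (u i) (p i).
  have uw : (u <= w)%O by apply/lefP => i; rewrite le_max lexx.
  have pw : (p <= w)%O by apply/lefP => i; rewrite le_max lexx orbT.
  exists w, uw, pw; split.
    apply/forallP => i; have/forallP/(_ i) := Pp; have /forallP/(_ i) := Pu.
    by rewrite /w; case: (leP (u i) (p i)).
  apply: genc => i; rewrite /w /p.
  have /forallP/(_ i) := Pu; move: (s_down i); case: (s i) => [[]|] //= _.
    rewrite eqbF_neg -leNgt => zu; left; apply/esym/max_idPr.
    by rewrite -lerBrDl sub0r in zu.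
  by right; rewrite le_max lexx orbT.
- by apply: hom_to_comb => //; exact: hom_to_pull.
- by rewrite /= gE ?lexx // g0E psiE scaleN1r addNr.
Qed.

(** Induction on the list [t] of positive coordinates: a box positive in direction
    [i] is the upper part of the box free in direction [i], whose lower part has
    one positive coordinate less and is needed one degree lower. *)
Lemma acyclic_box (d : int) (z : ZN) (t : seq 'I_N) s k :
  (forall k : nat, (k <= N)%N ->
     eventually_vanishes (chain_homology (d + k%:Z) C)) ->
  uniq t -> (forall i, s i != Some true) ->
  (exists2 i, i \notin t & s i = None) -> (size t <= k <= N)%N ->
  acyclic C (box (mark t s) z) (d + k%:Z).
Proof.
move=> C_van; elim: t s k => [|i t IHt] s k /= => [_|/andP[it t_uniq]] s_down.
  move=> [i _ si] kN; apply: acyclic_down_box => //; first exact: C_van.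
  by exists i.
move=> [i0]; rewrite in_cons negb_or => /andP[i0i i0t] si0 /andP[tk kN].
case: k tk kN => // k; rewrite ltnS => tk kN.
have e : d + k.+1%:Z = d + k%:Z + 1 by rewrite -addrA -PoszD addn1.
rewrite mark_cons -box_upper.
apply: (acyclic_upper C_free (@box_convex _ _ _) (@low_down _ _ _) e).
- rewrite upd_mark //; apply: IHt; rewrite // ?(leqW tk) //.
    by move=> j; rewrite /upd; case: (j == i).
  by exists i0; rewrite // /upd (negbTE i0i).
- rewrite box_lower upd_mark //; apply: IHt; rewrite // ?tk ?(ltnW kN) //.
    by move=> j; rewrite /upd; case: (j == i).
  by exists i0; rewrite // /upd (negbTE i0i).
Qed.

End Acyclicity.

(** * Exchanging all coordinates *)

Section Zigzag.
Variables (F : fieldType) (N : nat) (d : int).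
Local Notation ZN := ('I_N -> int).
Implicit Types (C D : chain_complex F N) (z : ZN) (t : seq 'I_N) (i : 'I_N).

(** The boxes met on the way: positive in the directions of [t], nonpositive in the
    others. For [t] empty this is the set of grades below [- z]. *)
Definition stair t z : pred ZN := box (mark t (fun=> Some false)) z.

(** The box that is cut by direction [i] to pass from [stair t z], its lower part,
    to [stair (i :: t) z], its upper part. *)
Definition landing t i z : pred ZN :=
  box (upd (mark t (fun=> Some false)) i None) z.

Lemma landing_lower t i z : i \notin t ->
  predI (landing t i z) (low i z) = stair t z :> pred ZN.
Proof.
move=> it; rewrite /landing box_lower upd_mark //.
by rewrite (upd_id (fun=> Some false) i).
Qed.

Lemma landing_upper t i z :
  predD (landing t i z) (low i z) = stair (i :: t) z :> pred ZN.
Proof. by rewrite /landing box_upper -mark_cons. Qed.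

(** The degree [n] is forced to be [d + size t]; it is kept as an index, and the
    differential as a datum, to avoid transporting cochains along equalities of
    degrees except at the start. *)
Fixpoint zigzag C z t n (f0 : forms (C d)) : forms (C n) -> Prop :=
  if t is i :: t' then fun g => exists j (e : n = j + 1) (f : forms (C j)),
    zigzag z t' f0 f /\ step (landing t' i z) (low i z) e f g
  else fun g => exists e : d = n, g = ecast m (forms (C m)) e f0.

Section OneComplex.
Variable C : chain_complex F N.
Hypothesis C_free : forall n : int, free_finite_rank (C n).
Variable z : ZN.

Lemma zigzag_comb t n a f0 f0' (g g' : forms (C n)) :
  zigzag z t f0 g -> zigzag z t f0' g' ->
  zigzag z t (comb a f0 f0') (comb a g g').
Proof.
elim: t n g g' => [|i t IHt] n g g' /=.
  move=> [e ->] [e' ->]; rewrite (eq_irrelevance e' e); exists e.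
  by case: n / e g g' e'.
move=> [j [e [f [zf fg]]]] [j' [e' [f' [zf' fg']]]].
have jj' : j' = j by apply: (addIr 1); rewrite -e' -e.
subst j'; rewrite (eq_irrelevance e' e) in fg'.
exists j, e, (comb a f f'); split; first exact: IHt.
exact: step_comb.
Qed.

Lemma zigzag_cocycle t n f0 (g : forms (C n)) : uniq t ->
  cocycle (stair [::] z) f0 -> zigzag z t f0 g -> cocycle (stair t z) g.
Proof.
move=> + f0c; elim: t n g => [|i t IHt] n g /= => [_ [e ->]|/andP[it t_uniq]].
  by case: n / e g.
move=> [j [e [f [/IHt-/(_ t_uniq) fc]]]]; rewrite -landing_upper.
by apply: step_cocycle; rewrite landing_lower.
Qed.

Lemma zigzag_total t n f0 : uniq t -> n = d + (size t)%:Z ->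
  cocycle (stair [::] z) f0 -> exists g : forms (C n), zigzag z t f0 g.
Proof.
move=> + + f0c; elim: t n => [|i t IHt] n /= => [_|/andP[it t_uniq]] nE.
  have e : d = n by rewrite nE addr0.
  by exists (ecast m (forms (C m)) e f0), e.
have [f zf] := IHt _ t_uniq erefl.
have e : n = d + (size t)%:Z + 1 by rewrite nE -addrA -PoszD addn1.
have [|g fg] := step_total C_free (P := landing t i z) (@box_convex _ _ _)
  (L := low i z) e (f := f).
  by rewrite landing_lower //; exact: zigzag_cocycle f0c zf.
by exists g, (d + (size t)%:Z), e, f.
Qed.

Lemma zigzag_coboundary t n (f0 : forms (C d)) (g : forms (C n)) : uniq t ->
  zigzag z t f0 g -> coboundary (stair [::] z) f0 -> coboundary (stair t z) g.
Proof.
move=> + + f0c; elim: t n g => [|i t IHt] n g /= => [_ [e ->]|/andP[it t_uniq]].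
  by case: n / e g.
move=> [j [e [f [/IHt-/(_ t_uniq) fc fg]]]]; rewrite -landing_upper.
by apply: step_coboundary fg _; rewrite ?landing_lower //; exact: box_convex.
Qed.

Hypothesis C_van : forall k : nat, (k <= N)%N ->
  eventually_vanishes (chain_homology (d + k%:Z) C).

Lemma acyclic_landing t i k : uniq t -> i \notin t -> (size t <= k <= N)%N ->
  acyclic C (landing t i z) (d + k%:Z).
Proof.
move=> t_uniq it tk; rewrite /landing upd_mark //.
apply: (acyclic_box C_free) => //; first by move=> j; rewrite /upd; case: (j == i).
by exists i; rewrite // /upd eqxx.
Qed.

Lemma zigzag_coboundary_inv t n f0 (g : forms (C n)) : uniq t ->
  n = d + (size t)%:Z -> (size t <= N)%N -> zigzag z t f0 g ->
  coboundary (stair t z) g -> coboundary (stair [::] z) f0.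
Proof.
elim: t n g => [|i t IHt] n g /= => [_ _ _ [e ->]|/andP[it t_uniq] nE tN].
  by case: n / e g.
move=> [j [e [f [zf fg]]]]; rewrite -landing_upper.
have jE : j = d + (size t)%:Z.
  by apply: (addIr 1); rewrite -e nE -addrA -PoszD addn1.
move=> /(step_coboundary_inv (@low_down _ _ _) _ fg); rewrite landing_lower //.
move=> fc; apply: IHt zf _ => //; first exact: ltnW.
by apply: fc; rewrite jE; apply: acyclic_landing; rewrite // leqnn ltnW.
Qed.

Lemma zigzag_onto t n (g : forms (C n)) : uniq t ->
  n = d + (size t)%:Z -> (size t <= N)%N -> cocycle (stair t z) g ->
  exists2 f0 : forms (C d), cocycle (stair [::] z) f0 & zigzag z t f0 g.
Proof.
elim: t n g => [|i t IHt] n g /= => [_|/andP[it t_uniq]] nE tN.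
  have e : d = n by rewrite nE addr0.
  by case: n / e g nE => g _ gc; exists g => //; exists erefl.
have e : n = d + (size t)%:Z + 1 by rewrite nE -addrA -PoszD addn1.
rewrite -landing_upper => /(step_onto (@low_down _ _ _) e)[|f].
  by rewrite nE; apply: acyclic_landing; rewrite // leqnSn.
rewrite landing_lower // => /(IHt _ _ t_uniq erefl (ltnW tN))[f0 f0c zf] fg.
by exists f0 => //; exists (d + (size t)%:Z), e, f.
Qed.

End OneComplex.

Lemma step_chain_map C D (phi : chain_map C D) (P L : pred ZN) j n
    (e : n = j + 1) (f : forms (D j)) (g : forms (D n)) :
  step P L e f g -> step P L e (pull (phi j) f) (pull (phi n) g).
Proof.
move=> [h [hP <- <-]]; exists (pull (phi j) h); split.
- exact: hom_to_pull.
- by apply: forms_ext => v x; rewrite /= !restrE.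
- by apply: forms_ext => v x; rewrite /= ch_map_comm.
Qed.

Lemma zigzag_chain_map C D (phi : chain_map C D) z t n f0 (g : forms (D n)) :
  zigzag z t f0 g -> zigzag z t (pull (phi d) f0) (pull (phi n) g).
Proof.
elim: t n g => [|i t IHt] n g /= => [[e ->]|[j [e [f [/IHt zf fg]]]]].
  by exists e; case: n / e g.
by exists j, e, (pull (phi j) f); split=> //; exact: step_chain_map.
Qed.

(** The positive constraints met by [u] at [z] persist when [u] or [z] increases,
    and the nonpositive ones met by [v] at [w] persist when [v] or [w] decreases.
    This is the condition of [hom_to_restr]. *)
Lemma box_shift s (z w u v : ZN) : (z <= w)%O -> (u <= v)%O ->
  box s z u -> box s w v -> box s w u && box s z v.
Proof.
move=> /lefP zw /lefP uv /forallP su /forallP sv.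
apply/andP; split; apply/forallP => i; move: (su i) (sv i);
  case: (s i) => // -[] /=; rewrite ?eqb_id ?eqbF_neg -?leNgt.
- by move=> zu _; apply: lt_le_trans zu _; rewrite lerD2r.
- by move=> _; apply: le_trans; rewrite lerD2l.
- by move=> zu _; apply: lt_le_trans zu _; rewrite lerD2l.
- by move=> _; apply: le_trans; rewrite lerD2r.
Qed.

Lemma hom_to_shift s (z w : ZN) (M : pmod F N) (f : forms M) : (z <= w)%O ->
  hom_to (box s z) f -> hom_to (box s w) (restr (box s w) f).
Proof. by move=> zw; apply: hom_to_restr => u v uv; exact: box_shift. Qed.

(** Passing from [z] to [w] truncates every cochain of the zigzag to the box at [w].
    The coboundary of the truncated lift [h] is the truncation of [g] because the
    coboundary of [h] vanishes on the lower part at [z], which contains the one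
    at [w]. *)
Lemma zigzag_shift C (z w : ZN) t n f0 (g : forms (C n)) : uniq t ->
  (z <= w)%O -> cocycle (stair [::] z) f0 -> zigzag z t f0 g ->
  zigzag w t (restr (stair [::] w) f0) (restr (stair t w) g).
Proof.
move=> + zw f0c; elim: t n g => [|i t IHt] n g /= => [_ [e ->]|/andP[it t_uniq]].
  by exists e; case: n / e g.
move=> [j [e [f [zf [h [hP hf hg]]]]]].
exists j, e, (restr (stair t w) f); split; first exact: IHt.
have low_shift v : low i w v -> low i z v.
  by rewrite /low -!leNgt; apply: le_trans; rewrite lerD2r; exact/lefP.
have [_ f0'] := zigzag_cocycle t_uniq f0c zf.
exists (restr (landing t i w) h); split; first exact: hom_to_shift hP.
  apply: forms_ext => v x; rewrite -hf -(landing_lower w it) !restrE /=.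
  case: ifP => // /andP[wv lv]; rewrite wv low_shift //.
  have [//|zv] := boolP (landing t i z v); case: hP => -> //.
apply: forms_ext => v x; rewrite -hg -landing_upper /= !restrE /=.
have [lv|] //= := boolP (low i w v); case: ifP => // wv.
have := f0' _ e v x; rewrite -hf restrE /= (low_shift v lv) andbT.
by case: ifP => // zv _; case: hP => -> //; rewrite zv.
Qed.

End Zigzag.

(** * Linear forms on homology as cocycles *)

Section HomologyForms.
Variables (F : fieldType) (N : nat) (d : int) (C : chain_complex F N).
Local Notation ZN := ('I_N -> int).
Variable z : ZN.
Hypothesis C_free : forall n : int, free_finite_rank (C n).
Implicit Types (alpha beta : dualv (chain_homology d C (- z))) (f : forms (C d)).

Lemma stair_nil : stair [::] z = (fun v : ZN => (v <= - z)%O).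
Proof.
apply: functional_extensionality_dep => v.
apply/forallP/lefP => h i; have := h i;
  by rewrite /= eqbF_neg -leNgt -lerBrDl sub0r.
Qed.

Local Notation bd := (ch_diff C (int_pred_succ d) (- z)).
Local Notation cycle_class := (cokerv_pi
  (pker_lift (@ch_diff2 _ _ C _ _ _ (erefl (d + 1)) (int_pred_succ d)) (- z))).

(** The cocycle attached to [alpha] is determined by a form on [C d (- z)], which
    must extend the pull-back of [alpha] to the cycles. *)
Definition lifts alpha f : Prop :=
  hom_to (stair [::] z) f /\
  forall x : kerv bd, f (- z) (val x) = alpha (cycle_class x).

Lemma lifts_comb a alpha beta f g :
  lifts alpha f -> lifts beta g -> lifts (a *: alpha + beta) (comb a f g).
Proof.
move=> [fz fE] [gz gE]; split=> [|x]; first exact: hom_to_comb.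
by rewrite /= fE gE.
Qed.

Lemma stair_nil_ext f g : hom_to (stair [::] z) f -> hom_to (stair [::] z) g ->
  (forall x, f (- z) x = g (- z) x) -> f = g.
Proof.
rewrite stair_nil => -[f0 fz] [g0 gz] fg; apply: forms_ext => v x.
have [h|h] := boolP (v <= - z)%O; last by rewrite f0 // g0.
by rewrite -(fz _ _ h) // -(gz _ _ h).
Qed.

Lemma lifts_total alpha : exists f, lifts alpha f.
Proof.
pose incl : {linear kerv bd -> C d (- z)} := val.
pose phi : {linear kerv bd -> F^o} := alpha \o cycle_class.
have [||psi psiE] := @factor_form F _ _ incl phi; first exact: free_pfd.
  move=> x x0; have -> : x = 0 by exact: val_inj.
  by rewrite linear0.
have [f fz fE] := hom_to_point psi.
by exists f; split=> [|x]; rewrite ?stair_nil // fE psiE.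
Qed.

Lemma cycle_class_bd (y : C (d + 1) (- z))
    (bdy : ch_diff C (erefl (d + 1)) (- z) y \in kerv_pred bd) :
  cycle_class (Kerv bdy) = 0.
Proof.
transitivity (cycle_class 0); last exact: linear0.
apply/cokerv_eqP; exists y.
by apply: val_inj; rewrite subr0.
Qed.

Lemma lifts_cocycle alpha f : lifts alpha f -> cocycle (stair [::] z) f.
Proof.
move=> [fz fE]; apply: (cocycleI (e := erefl (d + 1))) => // v x.
move: fz; rewrite stair_nil => -[f0 fz].
have [h|/f0 -> //] := boolP (v <= - z)%O.
rewrite -(fz _ _ h) // -phom_nat; set y := pm_map _ _ _.
have bdy : ch_diff C (erefl (d + 1)) (- z) y \in kerv_pred bd.
  by rewrite inE ch_diff2.
by rewrite -[ch_diff _ _ _ y]/(val (Kerv bdy)) fE cycle_class_bd linear0.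
Qed.

Lemma lifts0_coboundary f : lifts 0 f -> coboundary (stair [::] z) f.
Proof.
move=> [fz fE].
have [||psi psiE] := @factor_form F _ _ bd (f (- z)); first exact: free_pfd.
  by move=> x /eqP xK; rewrite -[x]/(val (Kerv (xK : x \in kerv_pred bd))) fE.
have [g] := hom_to_point psi; rewrite -stair_nil => gz gE.
exists (d - 1), (int_pred_succ d), g; split=> //.
apply: stair_nil_ext => [//||x]; first exact: hom_to_pull.
by rewrite /= gE psiE.
Qed.

Lemma lifts_coboundary_inv alpha f :
  lifts alpha f -> coboundary (stair [::] z) f -> alpha = 0.
Proof.
move=> [_ fE] /(coboundaryE (int_pred_succ d))[g _ fg].
apply: linear_ext => q; rewrite -[q](cokerv_reprK q) -fE fg /=.
by rewrite kervE linear0.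
Qed.

Lemma lifts_onto f : cocycle (stair [::] z) f -> exists alpha, lifts alpha f.
Proof.
move=> [fz f0].
pose phi : {linear kerv bd -> F^o} := f (- z) \o val.
have [||alpha alphaE] := @factor_form_surj F _ _ cycle_class phi.
- by move=> q; exists (cokerv_repr q); exact: cokerv_reprK.
- move=> x x0; have /cokerv_eqP[y] : cycle_class x = cycle_class 0.
    by rewrite x0 linear0.
  by rewrite subr0 /= => <-; exact: f0.
by exists alpha; split=> // x; rewrite alphaE.
Qed.

End HomologyForms.

(** * The global dual as a space of morphisms to a box *)

Section GlobalDualForms.
Variables (F : fieldType) (N : nat).
Local Notation ZN := ('I_N -> int).
Local Notation F1 := (free1 F (fun _ : 'I_N => 1)).
Local Notation top := (stair (enum 'I_N)).
Implicit Types (M : pmod F N) (z w v : ZN).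

Lemma stair_enum z v : top z v = ((fun=> 1) <= z + v)%O.
Proof.
have markE : mark (enum 'I_N) (fun=> Some false) = (fun=> Some true).
  by apply: functional_extensionality_dep => i; rewrite /mark mem_enum.
rewrite /stair markE; apply/forallP/lefP => h i; have := h i;
  by rewrite /= eqb_id gtz0_ge1.
Qed.

Definition forms_of z M (h : phom M (shift F1 z)) : forms M :=
  fun v => cell_form F ((fun=> 1) <= z + v)%O \o h v.

Lemma cell_formK b : cancel (cell_form F b) (form_cell F b).
Proof. by case: b => //= x; rewrite [x]thinmx0. Qed.

Lemma cell_form0 b (x : cell F b) : ~~ b -> cell_form F b x = 0.
Proof. by case: b x. Qed.

Lemma cell_form_map b c (x : cell F b) : b ==> c ->
  cell_form F c (@cell_map F b c x) = cell_form F b x.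
Proof. by move=> bc; exact: esym (cell_map_comp true x bc). Qed.

Lemma forms_of_inj z M : injective (@forms_of z M).
Proof.
move=> h k hk; apply: phom_ext => v x.
apply: (can_inj (@cell_formK _)).
exact: (f_equal (fun f : forms M => f v x) hk).
Qed.

Lemma forms_of_hom_to z M (h : phom M (shift F1 z)) : hom_to (top z) (forms_of h).
Proof.
split=> [v x|v w vw x]; rewrite stair_enum; first exact: cell_form0.
rewrite /forms_of /= phom_nat => _; apply: cell_form_map.
by apply/implyP => zv; exact: le_trans zv (addl_le z vw).
Qed.

Lemma forms_of_onto z M (f : forms M) : hom_to (top z) f ->
  exists h : phom M (shift F1 z), forms_of h = f.
Proof.
move=> [f0 fz].
pose h v : {linear M v -> shift F1 z v} :=
  form_cell F ((fun=> 1) <= z + v)%O \o f v.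
have h_nat v w (vw : (v <= w)%O) x :
    h w (pm_map M vw x) = pm_map (shift F1 z) vw (h v x).
  change (form_cell F ((fun=> 1) <= z + w)%O (f w (pm_map M vw x)) =
    pm_map (shift F1 z) vw (form_cell F ((fun=> 1) <= z + v)%O (f v x))).
  have [ow|nw] := boolP (top z w); last first.
    by apply: (can_inj (@cell_formK _)); rewrite !cell_form0 -?stair_enum.
  rewrite fz //; have [ov|nv] := boolP (top z v); last by rewrite f0 // !linear0.
  by apply: cell_map_comp; rewrite -!stair_enum ov.
exists (PHom h_nat); apply: forms_ext => v x.
change (cell_form F _ (form_cell F ((fun=> 1) <= z + v)%O (f v x)) = f v x).
have [ov|nv] := boolP (top z v).
  by move: ov; rewrite stair_enum /cell_form /form_cell /= => ->.
by rewrite f0 // !linear0.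
Qed.

Lemma forms_of_shift z w M (zw : (z <= w)%O) (h : phom M (shift F1 z)) :
  forms_of (phom_comp (shift_map F1 zw) h) = restr (top w) (forms_of h).
Proof.
rewrite -[LHS](restr_id (forms_of_hom_to _)); apply: forms_ext => v x.
rewrite !restrE; case: ifP => // _; apply: cell_form_map.
by apply/implyP => zv; exact: le_trans zv (addr_le v zw).
Qed.

End GlobalDualForms.

(** * Morphisms of persistence modules defined by relations *)

Section RelationsOfModules.
Variables (F : fieldType) (N : nat) (M L : pmod F N).
Local Notation ZN := ('I_N -> int).
Variable R : forall z : ZN, M z -> L z -> Prop.
Hypothesis R_lin : forall (z : ZN) a (x x' : M z) (y y' : L z),
  R x y -> R x' y' -> R (a *: x + x') (a *: y + y').
Hypothesis R_fun0 : forall (z : ZN) (y : L z), R 0 y -> y = 0.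
Hypothesis R_nat : forall (z w : ZN) (h : (z <= w)%O) (x : M z) (y : L z),
  R x y -> R (pm_map M h x) (pm_map L h y).
Hypothesis R_total : forall z (x : M z), exists y, R x y.

(** Choosing values of a relation that is linear and single-valued leaves no choice,
    so linearity and naturality of the relation pass to the function. *)
Lemma phom_of_rel : exists f : phom M L, forall z x, R x (f z x).
Proof.
pose f z := sval (cid (linear_of_rel (@R_lin z) (@R_fun0 z) (@R_total z))).
have Rf z x : R x (f z x) by rewrite /f; case: cid.
have f_nat z w (h : (z <= w)%O) x : f w (pm_map M h x) = pm_map L h (f z x).
  by apply: (rel_functional (@R_lin w) (@R_fun0 w)) (Rf _ _) _; exact: R_nat.
by exists (PHom f_nat).
Qed.

Lemma is_iso_of_rel (f : phom M L) : (forall z x, R x (f z x)) ->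
  (forall z (x : M z), R x 0 -> x = 0) ->
  (forall z (y : L z), exists x, R x y) -> is_iso f.
Proof.
move=> Rf R_inj R_onto.
have fE z x y : R x y -> f z x = y.
  exact: (rel_functional (@R_lin z) (@R_fun0 z) (Rf _ _)).
have f_inj z : injective (f z).
  move=> x y fxy; apply/eqP; rewrite -subr_eq0; apply/eqP/R_inj.
  by have := Rf z (x - y); rewrite linearB fxy subrr.
have f_onto z y : exists x, f z x = y by have [x /fE] := R_onto z y; exists x.
pose g z y := sval (cid (f_onto z y)).
have gK z : cancel (g z) (f z) by move=> y; rewrite /g; case: cid.
have g_lin z : linear (g z).
  by move=> a x y; apply: f_inj; rewrite linearP !gK.
pose gl z : {linear L z -> M z} :=
  HB.pack (g z) (GRing.isLinear.Build F _ _ *:%R (g z) (@g_lin z)).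
have g_nat z w (h : (z <= w)%O) y : gl w (pm_map L h y) = pm_map M h (gl z y).
  by apply: f_inj; rewrite phom_nat /= !gK.
exists (PHom g_nat); split; apply: phom_ext => z x /=; last exact: gK.
by apply: f_inj; rewrite gK.
Qed.

End RelationsOfModules.

(** * The duality isomorphism *)

Section Duality.
Variables (F : fieldType) (N : nat) (d : int).
Local Notation ZN := ('I_N -> int).
Local Notation axes := (enum 'I_N).
Local Notation deg := (d + N%:Z).
Implicit Types C D : chain_complex F N.

Local Notation cobd C := (gdual_map (ch_diff C (erefl (deg + 1)))).
Local Notation cocycle_class C z := (cokerv_pi
  (pker_lift (co_diff2 (c:=gdual_complex C)
    (int_pred_succ deg) (erefl (deg + 1))) z)).

(** The composite of three relations: from forms on homology to cocycles at the
    bottom, along the zigzag, and to the cohomology classes of the global dual. *)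
Definition corresponds C (z : ZN) (alpha : pdual (chain_homology d C) z)
    (q : cohomology deg (gdual_complex C) z) : Prop :=
  exists (f : forms (C d)) (x : kerv (cobd C z)),
    [/\ lifts alpha f, zigzag z axes f (forms_of (val x))
      & q = cocycle_class C z x].

Section OneComplex.
Variable C : chain_complex F N.
Variable z : ZN.

Lemma size_axes : size axes = N.
Proof. exact: size_enum_ord. Qed.

Lemma cocycle_forms_of (h : phom (C deg) (shift (free1 F (fun=> 1)) z)) :
  cocycle (stair axes z) (forms_of h) <-> h \in kerv_pred (cobd C z).
Proof.
split=> [[_ h0]|/eqP h0].
  apply/eqP; apply: forms_of_inj; apply: forms_ext => v x.
  rewrite [LHS](h0 _ (erefl (deg + 1))); exact: esym (linear0 _).
apply: (cocycleI (e := erefl (deg + 1))) => [|v x]; first exact: forms_of_hom_to.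
rewrite -[LHS]/(forms_of (cobd C z h) v x) h0; exact: linear0.
Qed.

Lemma cocycle_class_eq0 (x : kerv (cobd C z)) :
  cocycle_class C z x = 0 <-> coboundary (stair axes z) (forms_of (val x)).
Proof.
have -> : 0 = cocycle_class C z 0 by rewrite linear0.
split=> [/cokerv_eqP[k]|].
  rewrite subr0 => <-; exists (deg - 1), (int_pred_succ deg), (forms_of k).
  split; [exact: forms_of_hom_to | exact: forms_ext].
move=> /(coboundaryE (int_pred_succ deg))[g /forms_of_onto[k <-] xE].
apply/cokerv_eqP; exists k; apply: val_inj; rewrite subr0.
by apply: forms_of_inj; rewrite xE; exact: forms_ext.
Qed.

Lemma corresponds_lin a alpha beta p q :
  @corresponds C z alpha p -> corresponds beta q ->
  corresponds (a *: alpha + beta) (a *: p + q).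
Proof.
move=> [f [x [lf zf ->]]] [g [y [lg zg ->]]].
exists (comb a f g), (a *: x + y); split; first exact: lifts_comb.
  have -> : forms_of (val (a *: x + y)) =
      comb a (forms_of (val x)) (forms_of (val y)).
    apply: forms_ext => v u; exact: linearP.
  exact: zigzag_comb.
by rewrite linearP.
Qed.

Hypothesis C_free : forall n : int, free_finite_rank (C n).

Lemma corresponds_total alpha : exists q, @corresponds C z alpha q.
Proof.
have [f lf] := lifts_total C_free alpha.
have fc := lifts_cocycle lf.
have [|g zg] := zigzag_total C_free (t := axes) (n := deg) (enum_uniq _) _ fc.
  by rewrite size_axes.
have gc := zigzag_cocycle (enum_uniq _) fc zg.
have [h hg] := forms_of_onto gc.1; rewrite -hg in zg gc.
have /cocycle_forms_of hK := gc.
by exists (cocycle_class C z (Kerv hK)), f, (Kerv hK).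
Qed.

Lemma corresponds0 q : @corresponds C z 0 q -> q = 0.
Proof.
move=> [f [x [lf zf ->]]]; apply/cocycle_class_eq0.
by apply: (zigzag_coboundary C_free (enum_uniq _) zf); exact: lifts0_coboundary.
Qed.

Hypothesis C_van : forall k : nat, (k <= N)%N ->
  eventually_vanishes (chain_homology (d + k%:Z) C).

Lemma corresponds_inj alpha : @corresponds C z alpha 0 -> alpha = 0.
Proof.
move=> [f [x [lf zf /esym/cocycle_class_eq0 xb]]].
apply: (lifts_coboundary_inv lf).
apply: (zigzag_coboundary_inv C_free C_van (enum_uniq _) _ _ zf xb).
  by rewrite size_axes.
by rewrite size_axes.
Qed.

Lemma corresponds_onto q : exists alpha, @corresponds C z alpha q.
Proof.
pose x := cokerv_repr q.
have /cocycle_forms_of xc := valP x.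
have [||f fc zf] := zigzag_onto C_free C_van (enum_uniq _) _ _ xc.
- by rewrite size_axes.
- by rewrite size_axes.
have [alpha lf] := lifts_onto fc.
by exists alpha, f, x; split; rewrite // cokerv_reprK.
Qed.

End OneComplex.

Lemma corresponds_shift C (z w : ZN) (h : (z <= w)%O)
    (alpha : pdual (chain_homology d C) z) q :
  corresponds alpha q ->
  corresponds (pm_map (pdual (chain_homology d C)) h alpha)
    (pm_map (cohomology deg (gdual_complex C)) h q).
Proof.
move=> [f [x [lf zf ->]]].
exists (restr (stair [::] w) f), (pm_map (pker (cobd C)) h x); split.
- case: (lf) => fz fE; split=> [|y]; first exact: hom_to_shift fz.
  rewrite restrE stair_nil lexx.
  have /= := fE (pm_map (pker (ch_diff C (int_pred_succ d))) (opp_le h) y).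
  move: fz; rewrite stair_nil => -[_ fz]; rewrite fz // => ->.
  congr (alpha _); exact: (phom_nat (pcoker_proj _)).
- have -> : forms_of (val (pm_map (pker (cobd C)) h x)) =
      restr (stair axes w) (forms_of (val x)).
    exact: forms_of_shift.
  exact: zigzag_shift (enum_uniq _) h (lifts_cocycle lf) zf.
- exact: esym (phom_nat (pcoker_proj (pker_lift (co_diff2 (c:=gdual_complex C)
    (int_pred_succ deg) (erefl (deg + 1))))) h x).
Qed.

Lemma corresponds_chain_map C D (phi : chain_map C D) (z : ZN)
    (alpha : pdual (chain_homology d D) z) q :
  corresponds alpha q ->
  corresponds (pdual_map (chain_homology_map d phi) z alpha)
    (cohomology_map deg (gdual_chain_map phi) z q).
Proof.
move=> [f [x [[fz fE] zf ->]]].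
pose x' : kerv (cobd C z) :=
  Defs.cycle_map (co_map_comm (gdual_chain_map phi) (erefl (deg + 1))) z x.
exists (pull (phi d) f), x'; split.
- split=> [|y]; first exact: hom_to_pull.
  have /= -> := fE (Defs.cycle_map (ch_map_comm phi (int_pred_succ d)) (- z) y).
  congr (alpha _); apply: esym; exact: (pcoker_map_proj (homology_map_subproof2
    (ch_diff2 (erefl (d + 1)) (int_pred_succ d))
    (ch_diff2 (erefl (d + 1)) (int_pred_succ d))
    (ch_map_comm phi (erefl (d + 1))) (ch_map_comm phi (int_pred_succ d)))).
- have -> : forms_of (val x') = pull (phi deg) (forms_of (val x)).
    exact: forms_ext.
  exact: (zigzag_chain_map phi).
- exact: (pcoker_map_proj (homology_map_subproof2
    (co_diff2 (int_pred_succ deg) (erefl (deg + 1)))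
    (co_diff2 (int_pred_succ deg) (erefl (deg + 1)))
    (co_map_comm (gdual_chain_map phi) (int_pred_succ deg))
    (co_map_comm (gdual_chain_map phi) (erefl (deg + 1))))).
Qed.

End Duality.

Theorem theorem1p3 (F : fieldType) (N : nat) (d : int) :
  exists phi : forall C : chain_complex F N,
      (forall i : int, free_finite_rank (C i)) ->
      (forall k : nat, (k <= N)%N ->
         eventually_vanishes (chain_homology (d + k%:Z) C)) ->
      phom (pdual (chain_homology d C)) (cohomology (d + N%:Z) (gdual_complex C)),
    (forall C C_free C_van, is_iso (phi C C_free C_van)) /\
    (forall C D C_free C_van D_free D_van (f : chain_map C D),
       phom_comp (cohomology_map (d + N%:Z) (gdual_chain_map f))
                (phi D D_free D_van)
       = phom_comp (phi C C_free C_van) (pdual_map (chain_homology_map d f))).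
Proof.
have R_lin C z := @corresponds_lin F N d C z.
have phi_ex (C : chain_complex F N)
      (C_free : forall i : int, free_finite_rank (C i)) :
    exists f : phom (pdual (chain_homology d C))
                    (cohomology (d + N%:Z) (gdual_complex C)),
      forall z alpha, corresponds alpha (f z alpha).
  apply: phom_of_rel => z; first exact: R_lin.
  - exact: corresponds0.
  - by move=> w h alpha q; exact: corresponds_shift.
  - exact: corresponds_total.
exists (fun C C_free _ => sval (cid (phi_ex C C_free))).
split=> [C C_free C_van|C D C_free _ D_free _ f]; case: cid => /= phi phiR.
  apply: (is_iso_of_rel (R_lin C)) phiR _ _ => z.
  - exact: corresponds0.
  - exact: corresponds_inj.
  - exact: corresponds_onto.
case: cid => /= psi psiR; apply: phom_ext => z alpha.
apply: (rel_functional (@R_lin C z) (corresponds0 C_free)) (psiR _ _).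
by apply: corresponds_chain_map; exact: phiR.
Qed.
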